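(* Let $k$ be a field of characteristic $p>0$, $G$ a finite $p$-group with $|G|=p^n$. Fix a trace-surjective $G$-subalgebra $U=k[Y_0,\dots,Y_{n-1}]\le D_k$ such that: $U$ is a polynomial ring in $Y_0,\dots,Y_{n-1}$; $D_k=U\oplus I$ for some $G$-stable ideal $I\unlhd D_k$; the $G$-action on $U$ is triangular, i.e. for all $g\in G$ and all $i$, $(Y_i)g-Y_i\in k[Y_{i+1},\dots,Y_{n-1}]$; and $U^G=k[\sigma_0(\underline Y),\dots,\sigma_{n-1}(\underline Y)]$ is a polynomial ring in $\sigma_0,\dots,\sigma_{n-1}$. Let $R$ be a commutative $k$-algebra. Then every commutative trace-surjective $G$-algebra $A$ with given ring of invariants $A^G=R$ is of the form $$A\cong R[Y_0,\dots,Y_{n-1}]/(\sigma_0(\underline Y)-r_0,\dots,\sigma_{n-1}(\underline Y)-r_{n-1})$$ with suitable $r_0,\dots,r_{n-1}\in R$, and with $G$-action derived from the action on $U$ (that is, the isomorphism is $G$-equivariant, where $G$ acts trivially on $R$ and on the $Y_i$ as in $U$). The $\sigma_i$ can be determined explicitly and are of the form $$\sigma_i(\underline Y)=Y_i-Y_i^p+\gamma_i(Y_{i+1},\dots,Y_{n-1}),$$ with $\gamma_i$ a polynomial over $k$.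
   Context: All group actions are right actions. A $G$-algebra is a commutative $k$-algebra $A$ on which $G$ acts by $k$-algebra automorphisms; $A^G$ is the subring of $G$-fixed elements. The transfer map is $\mathrm{tr}:A\to A^G$, $a\mapsto\sum_{g\in G} ag$. A $G$-algebra $A$ is called trace-surjective if $\mathrm{tr}(A)=A^G$ (equivalently $1=\mathrm{tr}(a)$ for some $a\in A$). Let $V_{reg}=\bigoplus_{g\in G}kX_g$ be the regular right $kG$-module, with $(X_g)h=X_{gh}$. Define $D_k=D_k(G):=\mathrm{Sym}_k(V_{reg})/(\alpha)$ with $\alpha=-1+\sum_{g\in G}X_g$, with the induced $G$-action; it is a polynomial ring of Krull-dimension $|G|-1$. Subalgebras $U$ as in the claim exist for every finite $p$-group $G$. $\underline Y$ denotes $(Y_0,\dots,Y_{n-1})$.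
   Formalization: The last sentence fails for general U and σ (e.g. after rescaling Y_i); it is proved for suitably chosen generators σ_i of U^G when any g fixing Y_{i+1},…,Y_{n-1} moves Y_i by an element of F_p, and such a U is shown to exist; R and A are nonzero. *)

(* Defs.v *)
From HB Require Import structures.
From mathcomp Require Import all_boot all_algebra all_fingroup.
From mathcomp Require Import generic_quotient ring_quotient boolp mpoly.

Set Implicit Arguments.
Unset Strict Implicit.
Unset Printing Implicit Defensive.

Import GRing.Theory.
Local Open Scope ring_scope.
Local Open Scope quotient_scope.

(* In [comNzRingType] and [comAlgType] the zero ring is excluded; hence quotients
   are formed only by ideals that do not contain 1. *)

Section IdealQuotient.
Variables (k : comNzRingType) (B : comAlgType k) (m : nat) (s : 'I_m -> B).

Definition ideal_gen : {pred B} :=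
  fun x => `[< exists c : 'I_m -> B, x = \sum_i c i * s i >].

Hypothesis s_proper : 1 \notin ideal_gen.

Lemma ideal_gen_closed : idealr_closed ideal_gen.
Proof.
split=> //.
  by apply/asboolP; exists (fun=> 0); rewrite big1 // => i _; rewrite mul0r.
move=> a x y /asboolP[c ->] /asboolP[d ->]; apply/asboolP.
exists (fun i => a * c i + d i); rewrite mulr_sumr -big_split /=.
by apply: eq_bigr => i _; rewrite mulrDl mulrA.
Qed.

Definition ideal_pred of (1 \notin ideal_gen) : B -> bool := ideal_gen.

HB.instance Definition _ := isIdealr.Build B (ideal_pred s_proper)
  ideal_gen_closed.

Definition gen_idealr : idealr B := ideal_pred s_proper.

Definition alg_quot : Type := {ideal_quot gen_idealr}.

HB.instance Definition _ := GRing.ComNzRing.on alg_quot.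
HB.instance Definition _ := EqQuotient.on alg_quot.

Definition qpi (x : B) : alg_quot := \pi_({ideal_quot gen_idealr}) x.
Definition qrepr (x : alg_quot) : B :=
  repr (x : {ideal_quot gen_idealr}).

Lemma qreprK : cancel qrepr qpi.
Proof. by move=> x; exact: reprK. Qed.

Lemma qpi_is_zmod_morphism : zmod_morphism qpi.
Proof. exact: pi_is_zmod_morphism. Qed.
HB.instance Definition _ :=
  GRing.isZmodMorphism.Build B alg_quot qpi qpi_is_zmod_morphism.
Lemma qpi_is_monoid_morphism : monoid_morphism qpi.
Proof. exact: pi_is_monoid_morphism. Qed.
HB.instance Definition _ :=
  GRing.isMonoidMorphism.Build B alg_quot qpi qpi_is_monoid_morphism.

Lemma qpi_eq (x y : B) : qpi x = qpi y <-> x - y \in ideal_gen.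
Proof.
have := Quotient.idealrBE gen_idealr x y.
by rewrite -[_ \in ideal_gen]/(_ \in gen_idealr) => ->; split=> /eqP.
Qed.

Definition qscale (a : k) (x : alg_quot) : alg_quot := qpi a%:A * x.

Lemma qscaleA a b x : qscale a (qscale b x) = qscale (a * b) x.
Proof. by rewrite /qscale mulrA -rmorphM /= -in_algE -in_algE -rmorphM. Qed.
Lemma qscale1 : left_id 1 qscale.
Proof. by move=> x; rewrite /qscale scale1r rmorph1 mul1r. Qed.
Lemma qscaleDr : right_distributive qscale +%R.
Proof. by move=> a x y; rewrite /qscale mulrDr. Qed.
Lemma qscaleDl x : {morph qscale^~ x : a b / a + b}.
Proof. by move=> a b; rewrite /qscale scalerDl rmorphD mulrDl. Qed.
HB.instance Definition _ := GRing.Zmodule_isLmodule.Build k alg_quot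
  qscaleA qscale1 qscaleDr qscaleDl.

Lemma qscaleAl (a : k) (x y : alg_quot) : a *: (x * y) = a *: x * y.
Proof. exact: mulrA. Qed.
HB.instance Definition _ := GRing.Lmodule_isLalgebra.Build k alg_quot qscaleAl.
HB.instance Definition _ := GRing.Lalgebra_isComAlgebra.Build k alg_quot.

Lemma qpi_is_scalable : scalable qpi.
Proof.
move=> a x; rewrite -[in LHS](mul1r x) scalerAl rmorphM; exact: erefl.
Qed.
HB.instance Definition _ :=
  GRing.isScalable.Build k B alg_quot *:%R qpi qpi_is_scalable.

End IdealQuotient.

(* [mev y q] is [q (y_0, ..., y_{m-1})] in the [k]-algebra [A]. *)
Definition mev (k : comNzRingType) (A : comAlgType k) (m : nat) (y : 'I_m -> A)
  (q : {mpoly k[m]}) : A := mmap (in_alg A) y q.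

HB.instance Definition _ (k : comNzRingType) (A : comAlgType k) (m : nat)
  (y : 'I_m -> A) := GRing.RMorphism.copy (mev y) (mmap (in_alg A) y).

Lemma mevX (k : comNzRingType) (A : comAlgType k) (m : nat) (y : 'I_m -> A) i :
  mev y 'X_i = y i.
Proof. by rewrite /mev mmapX mmap1U. Qed.

Lemma mevZ (k : comNzRingType) (A : comAlgType k) (m : nat) (y : 'I_m -> A) :
  scalable (mev y).
Proof. by move=> c q; rewrite /mev mmapZ /= mulr_algl. Qed.

HB.instance Definition _ (k : comNzRingType) (A : comAlgType k) (m : nat)
  (y : 'I_m -> A) := GRing.isScalable.Build k {mpoly k[m]} A *:%R (mev y)
    (mevZ y).

Lemma mev_unique (k : comNzRingType) (A : comAlgType k) (m : nat)
  (f : {lrmorphism {mpoly k[m]} -> A}) q : f q = mev (fun i => f 'X_i) q.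
Proof.
rewrite [in LHS](mpolyE q) raddf_sum /mev /mmap; apply: eq_bigr => u _ /=.
rewrite linearZ mulr_algl; congr (_ *: _).
rewrite mpolyXE_id rmorph_prod; apply: eq_bigr => i _.
by rewrite rmorphXn.
Qed.

Definition base_change (k : comNzRingType) (R : comAlgType k) (m : nat)
  (q : {mpoly k[m]}) : {mpoly R[m]} := map_mpoly (in_alg R) q.

(* [q] lies in [k[X_{i+1}, ..., X_{m-1}]]. *)
Definition vars_above (k : comNzRingType) (m : nat) (i : 'I_m)
  (q : {mpoly k[m]}) : Prop :=
  forall u, u \in msupp q -> forall j : 'I_m, (j <= i)%N -> u j = 0%N.

Section GAlgebras.
Variables (k : comNzRingType) (G : finGroupType) (A : comAlgType k).
Variable to : {action G &-> A}.

Definition galg_action : Prop :=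
  forall g : G, linear (to^~ g) /\ monoid_morphism (to^~ g).

Definition ginvariant (a : A) : Prop := forall g : G, to a g = a.

Definition transfer (a : A) : A := \sum_(g : G) to a g.

Definition trace_surjective : Prop :=
  forall b, ginvariant b -> exists a, transfer a = b.

End GAlgebras.

Section Dk.
Variables (k : fieldType) (G : finGroupType).

(* [Sym_k(V_reg)] is the polynomial ring on variables indexed by [G]. *)
Definition symreg := {mpoly k[#|G|]}.

Definition regX (g : G) : symreg := 'X_(enum_rank g).

Definition reg_act (x : symreg) (h : G) : symreg :=
  mev (fun i => regX (enum_val i * h)%g) x.

Definition reg_alpha : symreg := -1 + \sum_(g : G) regX g.

Lemma reg_alpha_proper : 1 \notin ideal_gen (fun _ : 'I_1 => reg_alpha).
Proof.
apply/negP => /asboolP[c].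
rewrite big_ord1 => /(congr1 (meval (fun i => (i == enum_rank (1%g : G))%:R))).
rewrite rmorph1 rmorphM /= rmorphD /= rmorphN1 raddf_sum /=.
rewrite (bigD1 1%g) //= big1 => [|g g1]; last first.
  by rewrite /regX mevalXU (inj_eq enum_rank_inj) (negPf g1).
by rewrite /regX mevalXU eqxx addr0 addNr mulr0 => /eqP; rewrite oner_eq0.
Qed.

Definition Dk : comAlgType k := alg_quot reg_alpha_proper.

Definition Dpi : {lrmorphism symreg -> Dk} := qpi reg_alpha_proper.

Definition Drepr (x : Dk) : symreg := qrepr x.

Lemma DreprK : cancel Drepr Dpi.
Proof. exact: qreprK. Qed.

Definition Dact_fun (x : Dk) (h : G) : Dk := Dpi (reg_act (Drepr x) h).

Lemma reg_actX g h : reg_act (regX g) h = regX (g * h)%g.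
Proof. by rewrite /reg_act mevX enum_rankK. Qed.

Lemma reg_act_alpha h : reg_act reg_alpha h = reg_alpha.
Proof.
rewrite /reg_act rmorphD /= rmorphN1 raddf_sum /=; congr (_ + _).
rewrite [RHS](reindex_inj (mulIg h)) /=.
by apply: eq_bigr => g _; exact: reg_actX.
Qed.

Lemma Dact_pi x h : Dact_fun (Dpi x) h = Dpi (reg_act x h).
Proof.
rewrite /Dact_fun; apply/qpi_eq.
have /qpi_eq /asboolP[c] : Dpi (Drepr (Dpi x)) = Dpi x by exact: qreprK.
rewrite big_ord1 => e; apply/asboolP; exists (fun i => reg_act (c i) h).
rewrite big_ord1 -[reg_alpha in RHS](reg_act_alpha h) /reg_act.
by rewrite -rmorphB -rmorphM e.
Qed.

Lemma reg_act1 x : reg_act x 1 = x.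
Proof.
rewrite [RHS](mev_unique (@idfun symreg)); congr mmap; apply/funext => i.
by rewrite mulg1 /regX enum_valK.
Qed.

Lemma reg_actM x g h : reg_act x (g * h)%g = reg_act (reg_act x g) h.
Proof.
pose a g' : {lrmorphism symreg -> symreg} :=
  mev (fun i => regX (enum_val i * g')%g).
rewrite [RHS](mev_unique (a h \o a g)); congr mmap; apply/funext => i /=.
by rewrite /a !mevX enum_rankK mulgA.
Qed.

Lemma Dact1 : Dact_fun^~ 1%g =1 id.
Proof. by move=> x; rewrite /Dact_fun reg_act1 DreprK. Qed.

Lemma DactM x : act_morph Dact_fun x.
Proof.
by move=> g h; rewrite -(DreprK x) !Dact_pi reg_actM.
Qed.

Definition Dact : {action G &-> Dk} := TotalAction Dact1 DactM.

Lemma Dact_galg : galg_action Dact.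
Proof.
move=> g; split.
  move=> a x y; rewrite /= -(DreprK x) -(DreprK y).
  by rewrite -linearP !Dact_pi /reg_act !linearP.
split=> [|x y] /=.
  by rewrite -(rmorph1 Dpi) Dact_pi /reg_act !rmorph1.
rewrite -(DreprK x) -(DreprK y).
by rewrite -rmorphM !Dact_pi /reg_act !rmorphM.
Qed.

End Dk.

Section UniversalSubalgebra.
Variables (k : fieldType) (G : finGroupType) (n : nat).

Definition in_subalg (A : comAlgType k) (y : 'I_n -> A) (x : A) : Prop :=
  exists q : {mpoly k[n]}, x = mev y q.

(* The subalgebra [U] is the image of [mev y]; [F g i] is the polynomial
   expressing [(Y_i) g] in terms of the [Y_j], and [sigma i] is the polynomial
   [sigma_i]. *)
Record universal_subalg (y : 'I_n -> Dk k G) (F : G -> 'I_n -> {mpoly k[n]})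
    (sigma : 'I_n -> {mpoly k[n]}) : Prop := UniversalSubalg {
  us_alg_indep : injective (mev y);
  us_stable : forall g i, Dact k G (y i) g = mev y (F g i);
  us_trace_surjective : forall u, in_subalg y u -> ginvariant (Dact k G) u ->
    exists2 v, in_subalg y v & transfer (Dact k G) v = u;
  us_retract : exists I : {pred Dk k G},
    [/\ idealr_closed I,
        forall x g, x \in I -> Dact k G x g \in I,
        forall x, exists u v, [/\ in_subalg y u, v \in I & x = u + v]
      & forall x, in_subalg y x -> x \in I -> x = 0];
  us_triangular : forall g i, vars_above i (F g i - 'X_i);
  us_invariants : forall u, (in_subalg y u /\ ginvariant (Dact k G) u) <->
    in_subalg (fun i => mev y (sigma i)) u;
  us_sigma_alg_indep : injective (mev sigma)
}.

(* This is exactly the condition under which generators of the form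
   [Y_i - Y_i^p + gamma_i] can exist: replacing [Y_i] by [c Y_i] with
   [c ^+ (p - 1) != 1] keeps every condition of [universal_subalg] but destroys
   that form.  Whenever [g] fixes [Y_{i+1}, ..., Y_{n-1}], it translates [Y_i] by an
   element of the prime field. *)
Definition prime_field_steps (F : G -> 'I_n -> {mpoly k[n]}) : Prop :=
  forall g (i : 'I_n), (forall j : 'I_n, (i < j)%N -> F g j = 'X_j) ->
    exists c : nat, F g i = 'X_i + c%:R.

Definition artin_schreier_form (p : nat) (sigma : 'I_n -> {mpoly k[n]}) : Prop :=
  forall i, exists2 gamma : {mpoly k[n]},
    vars_above i gamma & sigma i = 'X_i - 'X_i ^+ p + gamma.

(* The action on [R[Y_0, ..., Y_{n-1}]] that is trivial on [R] and given on the
   [Y_i] as in [U]. *)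
Definition poly_act (R : comAlgType k) (F : G -> 'I_n -> {mpoly k[n]})
  (P : {mpoly R[n]}) (g : G) : {mpoly R[n]} :=
  mev (fun i => base_change R (F g i)) P.

Definition fiber_eqs (R : comAlgType k) (sigma : 'I_n -> {mpoly k[n]})
  (r : 'I_n -> R) (i : 'I_n) : {mpoly R[n]} :=
  base_change R (sigma i) - mpolyC n (r i).

End UniversalSubalgebra.

(* Main.v *)
Require Import Defs.
From HB Require Import structures.
From mathcomp Require Import all_boot all_algebra all_fingroup.
From mathcomp Require Import cyclic center pgroup nilpotent sylow.
From mathcomp Require Import boolp mpoly.

Set Implicit Arguments.
Unset Strict Implicit.
Unset Printing Implicit Defensive.

Import GRing.Theory.
Local Open Scope ring_scope.

(** Let P be the polynomial ring in Y_0, ..., Y_(n-1) over k with the action of G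
    that turns Y_i into F g i, and let tr be the sum over G.

    The structure theorem is Galois descent.  If A is trace-surjective, the
    universal property of D_k maps U, hence P, equivariantly to A; the images r_i
    of the sigma_i are invariant, so they lie in R.  Now P contains v with
    tr v = 1.  For g <> 1 the order of g is zero in k, and summing over the cosets
    of the group generated by g exhibits 1 as a combination of elements
    a * (b - b g) ([trace_one_moved]).  Multiplying these relations over all
    g <> 1 gives finitely many pairs (x_l, y_l) in P such that the sum of the
    x_l * (y_l g) is 1 for g = 1 and 0 otherwise ([galois_coordinates]).
    Consequently every a is the sum of the x_l * tr (a * y_l), in A as well as in
    R[Y].  In A the traces lie in R, so R[Y] -> A is onto ([descent_surjective]).
    In R[Y] the traces are polynomials in the sigma_i over R, hence become
    elements of R modulo the relations sigma_i = r_i; as R embeds into A, an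
    element that dies in A has zero traces modulo the relations and therefore lies
    in the ideal that they generate ([descent_kernel]).

    For the explicit sigma_i, let N_i be the subgroup fixing Y_i, ..., Y_(n-1).
    If the steps are in the prime field, the quotient of N_(i+1) by N_i translates
    Y_i by elements of F_p, and the order p^n of G leaves no slack: each of these
    quotients has order p ([kernel_tower]).  Since the sum of (x + m)^a over m < p
    is 0 for a < p - 1 and -1 for a = p - 1, multiplying by - Y_i^(p-1) carries an
    element of relative trace 1 from one level to the next ([trace_one_refine]).
    Such an element splits cocycles, so Y_i - Y_i^p can be corrected by a
    polynomial gamma_i in the later variables to an invariant sigma_i.  The same
    power sums show that every trace is a polynomial in the sigma_i, and
    v = tr (v * w) when v is invariant and tr w = 1 ([tower_invariants]).

    For existence, choose a chain of normal subgroups N_i of order p^i, functions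
    b_i on G which are coordinates on the cosets of N_(i+1) modulo N_i, and let E
    be the space of functions on G.  An action on P is built one variable at a
    time together with a linear map s from E to P which is equivariant on the
    functions invariant under N_i and maps 1 to 1 and b_j to Y_j: the rule
    Y_i g = Y_i + s (b_i g - b_i) is consistent because b_i g - b_i is invariant
    under N_(i+1), and s is then extended by averaging against an element of
    relative trace 1 ([partial_model_down]).  In the end s induces an equivariant
    surjection of D_k onto P, which splits because the obstructions to lifting the
    Y_i equivariantly are cocycles with values in its kernel, and these are killed
    by the trace-one element X_1 of D_k ([lifted_down]). *)

(** * Power sums over the prime field *)
Section PowerSums.
Variables (k : fieldType) (p : nat).
Hypothesis chark : p \in [pchar k].

Let p_prime : prime p := pcharf_prime chark.

Definition power_sum (a : nat) : k := \sum_(m < p) m%:R ^+ a.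

Lemma natr_inj_lt (i j : nat) : (i < p)%N -> (j < p)%N ->
  (i%:R : k) = j%:R -> i = j.
Proof.
wlog le_ij : i j / (i <= j)%N.
  by move=> H; case/orP: (leq_total i j) => le Hi Hj e; [|symmetry];
    apply: H.
move=> ip jp /eqP; rewrite eq_sym -subr_eq0 -natrB // -(dvdn_pcharf chark).
rewrite /dvdn modn_small; last by rewrite (leq_ltn_trans (leq_subr _ _)).
by rewrite subn_eq0 => le_ji; apply/eqP; rewrite eqn_leq le_ij.
Qed.

Lemma natr_mod (m : nat) : (m %% p)%:R = m%:R :> k.
Proof.
by rewrite [in RHS](divn_eq m p) natrD natrM (pcharf0 chark) mulr0 add0r.
Qed.

Lemma nat_expp (m : nat) : (m%:R : k) ^+ p = m%:R.
Proof. by rewrite -(pFrobenius_autE chark) pFrobenius_aut_nat. Qed.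

(** The m%:R for m < p run through the prime field, which translation permutes. *)
Lemma power_sum_shift (a l : nat) :
  \sum_(m < p) ((l + m)%:R : k) ^+ a = power_sum a.
Proof.
elim: l => [|l IH]; first by apply: eq_bigr.
rewrite -IH; case: p chark => [|q] chq; first by rewrite !big_ord0.
rewrite big_ord_recr big_ord_recl /= addrC addn0; congr (_ + _).
  by rewrite addSnnS natrD (pcharf0 chq) addr0.
by apply: eq_bigr => i _; rewrite addSnnS.
Qed.

(** As a polynomial in [x] the left side has degree less than [p], and it takes the
    same value at all [p] points of the prime field. *)
Lemma sum_translates (A : comAlgType k) (x : A) a : (a < p)%N ->
  \sum_(m < p) (x + m%:R) ^+ a = (power_sum a)%:A.
Proof.
move=> a_lt; pose P : {poly k} :=
  \sum_(m < p) ('X + (m%:R)%:P) ^+ a - (power_sum a)%:P.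
have szP : (size P <= p)%N.
  rewrite (leq_trans (size_polyD _ _)) // size_polyN geq_max.
  rewrite (leq_trans (size_polyC_leq1 _)) ?prime_gt0 // andbT.
  apply: (leq_trans (size_sum _ _ _)); apply/bigmax_leqP => i _.
  by rewrite -[_%:P]opprK -polyCN size_exp_XsubC.
have rootP : all (root P) [seq m%:R | m <- iota 0 p].
  apply/allP => _ /mapP[l _ ->]; apply/rootP.
  rewrite /P !hornerE horner_sum; apply/eqP; rewrite subr_eq0; apply/eqP.
  rewrite -(power_sum_shift a l); apply: eq_bigr => i _.
  by rewrite !hornerE natrD.
have uniqP : uniq [seq (m%:R : k) | m <- iota 0 p].
  rewrite map_inj_in_uniq ?iota_uniq // => i j; rewrite !mem_iota /= add0n.
  exact: natr_inj_lt.
have /eqP : P = 0.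
  apply/eqP; case: (eqVneq P 0) => // nzP.
  have := max_poly_roots nzP rootP uniqP.
  by rewrite size_map size_iota ltnNge szP.
rewrite subr_eq0 => /eqP /(congr1 (horner_alg x)).
rewrite rmorph_sum horner_algC => <-; apply: eq_bigr => i _.
by rewrite rmorphXn rmorphD /= horner_algX horner_algC scaler_nat.
Qed.

Lemma power_sum_pred : power_sum p.-1 = -1.
Proof.
rewrite /power_sum; case: p chark p_prime => // q chq pq /=.
have q_gt0 : (0 < q)%N by have := prime_gt1 pq.
rewrite big_ord_recl expr0n (gtn_eqF q_gt0) add0r.
rewrite (eq_bigr (fun=> 1)) => [|i _].
  rewrite sumr_const card_ord; apply/eqP.
  by rewrite -subr_eq0 opprK -mulrSr (pcharf0 chq).
have nz : (i.+1%:R : k) != 0.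
  rewrite -(dvdn_pcharf chq); apply: contraL (ltn_ord i) => /dvdn_leq.
  by rewrite -leqNgt; apply.
apply: (mulfI nz); rewrite mulr1 -exprS.
by rewrite -(pFrobenius_autE chq) pFrobenius_aut_nat.
Qed.

End PowerSums.

(** * Relative traces and the splitting of cocycles *)
Section RelativeTraces.
Variables (k : fieldType) (G : finGroupType).

Definition is_act (A : comAlgType k) (act : G -> {lrmorphism A -> A}) : Prop :=
  (forall a, act 1%g a = a) /\ (forall g h a, act (g * h)%g a = act h (act g a)).

(** A weight replaces a choice of representatives for the cosets of [N]: weighted sums
    over [G] of functions constant on these cosets are sums over the quotient. *)
Definition weight (N : {set G}) (theta : G -> k) : Prop :=
  forall g, \sum_(z in N) theta (z * g)%g = 1.

(** Insert the sum of [theta'] over a coset of [N], exchange the sums, and read the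
    other sum as one of [theta]. *)
Lemma weight_sum_indep (V : lmodType k) (N : {group G}) (theta theta' : G -> k)
    (phi : G -> V) :
  weight N theta -> weight N theta' ->
  (forall z g, z \in N -> phi (z * g)%g = phi g) ->
  \sum_g theta g *: phi g = \sum_g theta' g *: phi g.
Proof.
move=> wt wt' phiN.
transitivity (\sum_g \sum_(z in N) (theta g * theta' (z * g)%g) *: phi g).
  by apply: eq_bigr => g _; rewrite -scaler_suml -mulr_sumr wt' mulr1.
rewrite exchange_big /=.
transitivity (\sum_(z in N) \sum_g (theta (z^-1 * g)%g * theta' g) *: phi g).
  apply: eq_bigr => z Nz; rewrite [RHS](reindex_inj (mulgI z)) /=.
  by apply: eq_bigr => g _; rewrite mulKg phiN.
rewrite exchange_big; apply: eq_bigr => g _ /=.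
rewrite -scaler_suml -mulr_suml (reindex_inj invg_inj) /=.
rewrite (eq_big [pred z | z \in N] (fun z => theta (z * g)%g)) ?wt ?mul1r //.
  by move=> z; rewrite groupV.
by move=> z _; rewrite invgK.
Qed.

Lemma weight_sum_translate (V : lmodType k) (N : {group G}) (theta : G -> k)
    (phi : G -> V) h :
  weight N theta -> (forall z g, z \in N -> phi (z * g)%g = phi g) ->
  \sum_g theta g *: phi (g * h)%g = \sum_g theta g *: phi g.
Proof.
move=> wt phiN; rewrite [LHS](reindex_inj (mulIg h^-1%g)) /=.
under eq_bigr do rewrite mulgKV.
apply: (weight_sum_indep _ wt) phiN => g.
by under eq_bigr do rewrite -mulgA; exact: wt.
Qed.

Lemma weight_one : weight 1%g (fun=> 1).
Proof. by move=> g; rewrite big_set1. Qed.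

Lemma weight_setT : weight [set: G] (fun g => (g == 1%g)%:R).
Proof.
move=> g; rewrite (bigD1 g^-1%g) ?inE //= mulVg eqxx big1 ?addr0 // => z.
by case/andP=> _ /negPf; rewrite -eq_invg_mul eqg_invLR => ->.
Qed.

(** A normal subgroup [N] of index [p] in [M], given by the isomorphism of the quotient
    with the prime field: [c] is the logarithm to the base [z]. *)
Record prime_step (N M : {group G}) (z : G) (c : G -> k) : Prop := PrimeStep {
  step_sub : N \subset M;
  step_mem : z \in M;
  step_gen : c z = 1;
  step_morph : {in M &, forall x y, c (x * y)%g = c x + c y};
  step_nat : forall x, x \in M -> exists m : nat, c x = m%:R;
  step_ker : forall x, x \in M -> (c x = 0 <-> x \in N)
}.

Variable p : nat.
Hypothesis chark : p \in [pchar k].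

Lemma step_expg N M z c (m : nat) : prime_step N M z c -> c (z ^+ m)%g = m%:R.
Proof.
move=> st; elim: m => [|m IH].
  by rewrite expg0; apply/(step_ker st) => //; apply: group1.
rewrite expgS (step_morph st) ?groupX ?(step_mem st) //.
by rewrite IH (step_gen st) -mulrS.
Qed.

(** On the products [z ^+ m * x] the map [c] takes each value of the prime field once. *)
Lemma step_unique N M z c x : prime_step N M z c -> x \in M ->
  exists m0 : 'I_p, forall m : 'I_p, (z ^+ m * x \in N)%g = (m == m0).
Proof.
move=> st Mx; have [l cx] := step_nat st Mx.
have p_gt0 : (0 < p)%N := prime_gt0 (pcharf_prime chark).
have lt0 : ((p - l %% p) %% p < p)%N by rewrite ltn_mod.
have c0 : ((p - l %% p) %% p)%:R + c x = 0.
  by rewrite cx natr_mod // -[l%:R](natr_mod chark) -natrD subnK ?(pcharf0 chark) //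
    ltnW // ltn_mod.
exists (Ordinal lt0) => m.
have cm : c (z ^+ m * x)%g = m%:R + c x.
  by rewrite (step_morph st) ?groupX ?(step_mem st) // (step_expg _ st).
have Mzx : (z ^+ m * x \in M)%g by rewrite groupM ?groupX ?(step_mem st).
apply/idP/eqP => [/(step_ker st Mzx)|->].
  rewrite cm -{}c0 => /addIr /(natr_inj_lt chark) e.
  by apply: val_inj; apply: e.
apply/(step_ker st); last by rewrite (step_morph st) ?groupX ?(step_mem st)
  // (step_expg _ st).
by rewrite groupM ?groupX ?(step_mem st).
Qed.

Lemma step_sum (V : nmodType) N M z c (f : G -> V) : prime_step N M z c ->
  \sum_(x in M) f x = \sum_(m < p) \sum_(y in N) f (z ^- m * y)%g.
Proof.
move=> st.
transitivity (\sum_(x in M) \sum_(m < p | (z ^+ m * x)%g \in N) f x).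
  apply: eq_bigr => x Mx; have [m0 Hm] := step_unique st Mx.
  by rewrite (eq_bigl (pred1 m0)) ?big_pred1_eq.
rewrite (exchange_big_dep predT) //=; apply: eq_bigr => m _.
rewrite (reindex_inj (mulgI (z ^- m)%g)) /=; apply: eq_bigl => y.
rewrite mulKVg groupMl ?groupV ?groupX ?(step_mem st) //.
case: (boolP (y \in N)); rewrite ?andbF ?andbT //.
by move/(subsetP (step_sub st)).
Qed.

Lemma step_card N M z c : prime_step N M z c -> #|M| = (p * #|N|)%N.
Proof.
move=> st; have := @step_sum nat N M z c (fun=> 1%N) st.
rewrite sum1_card => ->; under eq_bigr do rewrite sum1_card.
by rewrite sum_nat_const card_ord.
Qed.

Definition refine_weight (z : G) (theta : G -> k) (g : G) : k :=
  \sum_(m < p) theta (z ^- m * g)%g.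

Lemma weight_step N M z c theta : prime_step N M z c ->
  weight M theta -> weight N (refine_weight z theta).
Proof.
move=> st wt g; rewrite exchange_big /= -(wt g) (step_sum _ st) /=.
by apply: eq_bigr => m _; apply: eq_bigr => y _; rewrite mulgA.
Qed.

Variables (A : comAlgType k) (act : G -> {lrmorphism A -> A}).
Hypothesis actP : is_act act.

Definition relative_trace (theta : G -> k) (a : A) : A :=
  \sum_g theta g *: act g a.

Lemma relative_traceM (theta : G -> k) (a b : A) :
  (forall g, act g a = a) ->
  relative_trace theta (a * b) = a * relative_trace theta b.
Proof.
move=> fix_a; rewrite mulr_sumr; apply: eq_bigr => g _.
by rewrite rmorphM /= fix_a scalerAr.
Qed.

Lemma relative_traceD (theta : G -> k) (a b : A) :
  relative_trace theta (a + b) = relative_trace theta a + relative_trace theta b.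
Proof.
by rewrite -big_split; apply: eq_bigr => g _; rewrite rmorphD scalerDr.
Qed.

(** The refined weight sums over the powers of [z] first, and these translate [x] by
    the elements of the prime field. *)
Lemma relative_trace_refine (theta : G -> k) (z : G) (v x : A) a :
  (a < p)%N -> act z v = v -> act z x = x + 1 ->
  relative_trace (refine_weight z theta) (v * x ^+ a) =
  power_sum k p a *: relative_trace theta v.
Proof.
move=> ap fix_v step_x; rewrite /relative_trace scaler_sumr.
have zm m : act (z ^+ m)%g v = v /\ act (z ^+ m)%g x = x + m%:R.
  elim: m => [|m [IHv IHx]]; first by rewrite expg0 !actP.1 addr0.
  by rewrite expgS !actP.2 fix_v step_x IHv rmorphD rmorph1 /= IHx -addrA -mulrSr.
under eq_bigr do rewrite scaler_suml.
rewrite exchange_big /=.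
transitivity (\sum_(m < p) \sum_g theta g *: act g (v * (x + m%:R) ^+ a)).
  apply: eq_bigr => m _; rewrite (reindex_inj (mulgI (z ^+ m)%g)) /=.
  by apply: eq_bigr => g _; rewrite mulKg actP.2 rmorphM rmorphXn /=
    (zm m).1 (zm m).2.
rewrite exchange_big /=; apply: eq_bigr => g _.
rewrite -scaler_sumr -rmorph_sum -mulr_sumr (sum_translates chark _ ap) /=.
by rewrite [v * _]mulrC mulr_algl linearZ /= !scalerA mulrC.
Qed.

(** Among the exponents below p, only p - 1 has a nonzero power sum, namely -1. *)
Lemma trace_one_refine (theta : G -> k) (z : G) (w x : A) :
  relative_trace theta w = 1 -> act z w = w -> act z x = x + 1 ->
  relative_trace (refine_weight z theta) (- (w * x ^+ p.-1)) = 1.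
Proof.
move=> tr_w fix_w step_x.
have -> : - (w * x ^+ p.-1) = (-1)%:A * (w * x ^+ p.-1).
  by rewrite scaleN1r mulN1r.
have p_gt1 := prime_gt1 (pcharf_prime chark).
rewrite relative_traceM => [|g]; last by rewrite linearZ /= rmorph1.
rewrite relative_trace_refine ?ltn_predL ?(ltnW p_gt1) // tr_w.
by rewrite power_sum_pred // !scaleN1r mulrNN mulr1.
Qed.

(** The vanishing of the first cohomology group in the presence of an element of
    relative trace 1, with an explicit splitting [b]: it stays in any stable ideal
    or subring that contains the values [act g w * e g]. *)
Lemma cocycle_split (N : {group G}) (theta : G -> k) (w : A) (e : G -> A) :
  weight N theta -> (forall z, z \in N -> act z w = w) ->
  relative_trace theta w = 1 ->
  (forall g h, e (g * h)%g = act h (e g) + e h) ->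
  (forall z, z \in N -> e z = 0) ->
  let b := \sum_g theta g *: (act g w * e g) in
  forall h, act h b - b = - e h.
Proof.
move=> wt fix_w tr_w cocyc e0 b h.
have eN z g : z \in N -> act (z * g)%g w * e (z * g)%g = act g w * e g.
  by move=> Nz; rewrite actP.2 fix_w // cocyc e0 // rmorph0 add0r.
have <- : b - e h = act h b.
  rewrite {1}/b -(weight_sum_translate h wt eN) -[e h]mul1r.
  rewrite -tr_w -{1}[relative_trace _ _](weight_sum_translate h wt).
    rewrite mulr_suml -sumrB rmorph_sum; apply: eq_bigr => g _ /=.
    rewrite linearZ /= rmorphM /= -scalerAl -scalerBr -mulrBr cocyc addrK.
    by rewrite actP.2.
  by move=> z g Nz; rewrite actP.2 fix_w.
by rewrite addrAC subrr add0r.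
Qed.

End RelativeTraces.

(** * Trace-one elements give Galois coordinates *)
Section GaloisCoordinates.
Variables (k : fieldType) (G : finGroupType) (p : nat).
Hypotheses (chark : p \in [pchar k]) (pG : (p.-group [set: G])%g).
Variables (A : comAlgType k) (act : G -> {lrmorphism A -> A}).
Hypothesis actP : is_act act.

(** The ideal that defines the fixed-point scheme of [g] on the spectrum of [A]. *)
Definition moved (g : G) (x : A) : Prop :=
  exists s : seq (A * A), x = \sum_(ab <- s) ab.1 * (ab.2 - act g ab.2).

Lemma moved0 g : moved g 0.
Proof. by exists [::]; rewrite big_nil. Qed.

Lemma movedD g x y : moved g x -> moved g y -> moved g (x + y).
Proof. by move=> [s ->] [t ->]; exists (s ++ t); rewrite big_cat. Qed.

Lemma moved_sum g I (r : seq I) (P : pred I) (f : I -> A) :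
  (forall i, P i -> moved g (f i)) -> moved g (\sum_(i <- r | P i) f i).
Proof. by move=> H; apply: big_ind => //; [exact: moved0 | exact: movedD]. Qed.

Lemma moved_iter g b i : moved g (act (g ^+ i)%g b - b).
Proof.
elim: i => [|i IH]; first by rewrite expg0 actP.1 subrr; apply: moved0.
rewrite expgSr actP.2 -(subrK (act (g ^+ i)%g b) (act g _)) -addrA.
apply: movedD => //; exists [:: (-1, act (g ^+ i)%g b)].
by rewrite big_seq1 /= mulN1r opprB.
Qed.

(** Modulo the ideal generated by the [b - b g], summing over [G] multiplies a sum over
    coset representatives by the order of [g], which is zero in [k]; so 1 is zero
    modulo this ideal. *)
Lemma trace_one_moved v g : \sum_h act h v = 1 -> g != 1%g -> moved g 1.
Proof.
move=> tr1 g1; pose H : {group G} := <[g]>%G.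
pose theta (h : G) : k := (h == repr (h *: H)%g)%:R.
have wt h : \sum_(z in H) theta (h * z)%g = 1.
  pose y := (h^-1 * repr (h *: H))%g.
  have Hy : y \in H by rewrite -mem_lcoset (mem_repr h) ?lcoset_refl.
  rewrite (bigD1 y) //= big1 => [|z /andP[Hz neq]].
    by rewrite addr0 /theta lcosetM lcoset_id // mulKVg eqxx.
  rewrite /theta lcosetM lcoset_id // -(inj_eq (mulgI h^-1%g)) mulKg.
  by rewrite (negPf neq).
pose b := \sum_h theta h *: act h v.
have -> : 1 = \sum_(z in H) (act z b - b).
  rewrite sumrB sumr_const -[#|H|]/(#[g]%g).
  have -> : b *+ #[g]%g = 0.
    rewrite -scaler_nat; have [|m ->] := dvdnP (_ : (p %| #[g]%g)%N).
      have [m om] := p_natP (mem_p_elt pG (in_setT g)).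
      case: m om => [/eqP|m ->]; last by rewrite expnS dvdn_mulr.
      by rewrite expn0 order_eq1 (negPf g1).
    by rewrite natrM (pcharf0 chark) mulr0 scale0r.
  rewrite subr0 -[LHS]tr1.
  transitivity (\sum_h \sum_(z in H) theta (h * z)%g *: act h v).
    by apply: eq_bigr => h _; rewrite -scaler_suml wt scale1r.
  rewrite exchange_big [RHS](reindex_inj invg_inj) /=.
  apply: eq_big => z; first by rewrite groupV.
  move=> Hz; rewrite (reindex_inj (mulIg z^-1%g)) rmorph_sum /=.
  by apply: eq_bigr => h _; rewrite mulgKV linearZ /= actP.2.
apply: moved_sum => _ /cycleP[i ->]; exact: moved_iter.
Qed.

(** A list of pairs stands for an element of the tensor square of [A]; multiplying the
    right factors by [g] and contracting is a ring morphism for every [g]. *)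
Definition pairing (s : seq (A * A)) (g : G) : A :=
  \sum_(ab <- s) ab.1 * act g ab.2.

Lemma moved_pairing g : moved g 1 ->
  exists2 s, pairing s 1%g = 1 & pairing s g = 0.
Proof.
move=> [s e]; exists ((- pairing s g, 1) :: s); rewrite /pairing big_cons /=.
  rewrite actP.1 mulr1 [RHS]e addrC.
  under [RHS]eq_bigr do rewrite mulrBr.
  by rewrite sumrB; congr (_ - _); apply: eq_bigr => ab _; rewrite actP.1.
by rewrite rmorph1 mulr1 addNr.
Qed.

Definition pairing_mul (s t : seq (A * A)) : seq (A * A) :=
  [seq (a.1 * b.1, a.2 * b.2) | a <- s, b <- t].

Lemma pairing_mulE s t g :
  pairing (pairing_mul s t) g = pairing s g * pairing t g.
Proof.
rewrite /pairing big_allpairs_dep mulr_suml; apply: eq_bigr => a _.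
rewrite mulr_sumr; apply: eq_bigr => b _ /=.
by rewrite rmorphM mulrACA.
Qed.

(** The product over all [g != 1] of elements of the tensor square that contract to 1
    at the identity and to 0 at [g]. *)
Lemma galois_coordinates v : \sum_h act h v = 1 ->
  exists s, forall g, pairing s g = (g == 1%g)%:R.
Proof.
move=> tr1.
suff [s s1 s0] : exists2 s, pairing s 1%g = 1 &
    forall g, g \in [seq g <- enum G | g != 1%g] -> pairing s g = 0.
  exists s => g; have [->//|g1] := eqVneq; apply: s0.
  by rewrite mem_filter g1 mem_enum.
elim: (enum G) => [|h r [s s1 s0]] /=.
  by exists [:: (1, 1)] => //; rewrite /pairing big_seq1 /= rmorph1 mulr1.
case: ifP => h1; last by exists s.
have [t t1 t0] := moved_pairing (trace_one_moved tr1 h1).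
exists (pairing_mul t s); first by rewrite pairing_mulE t1 s1 mulr1.
move=> g; rewrite inE pairing_mulE => /predU1P[->|/s0->].
  by rewrite t0 mul0r.
by rewrite mulr0.
Qed.

End GaloisCoordinates.

(** * Polynomials in the last variables *)
Lemma down_ind (n : nat) (Q : nat -> Prop) : Q n ->
  (forall i : 'I_n, Q i.+1 -> Q i) -> forall i, (i <= n)%N -> Q i.
Proof.
move=> Qn step i le_in; rewrite -(subKn le_in).
elim: (n - i)%N (leq_subr i n) => [|m IH]; first by rewrite subn0.
move=> lt_mn; have lt' : (n - m.+1 < n)%N.
  by rewrite ltn_subrL (leq_ltn_trans _ lt_mn).
apply: (step (Ordinal lt')); rewrite /= -subSn // subSS.
exact: IH (ltnW lt_mn).
Qed.

Section UpperPolynomials.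
Variables (k : comNzRingType) (n : nat).
Local Notation P := {mpoly k[n]}.
Implicit Types (q : P).

Lemma mpoly_rmorph_ext (S : nzRingType) (f g : {rmorphism P -> S}) :
  (forall c, f c%:MP = g c%:MP) -> (forall i, f 'X_i = g 'X_i) -> f =1 g.
Proof.
move=> eC eX q; rewrite (mpolyE q) !rmorph_sum; apply: eq_bigr => u _ /=.
rewrite -mul_mpolyC !rmorphM eC mpolyXE_id; congr (_ * _).
rewrite !rmorph_prod; apply: eq_bigr => i _.
by rewrite !rmorphXn eX.
Qed.

Lemma mevC (A : comAlgType k) (y : 'I_n -> A) c : mev y c%:MP = c%:A.
Proof. by rewrite /mev mmapC. Qed.

Lemma mev_comp (A B : comAlgType k) (f : {lrmorphism A -> B}) (y : 'I_n -> A) q :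
  f (mev y q) = mev (f \o y) q.
Proof.
rewrite [LHS](mev_unique (f \o mev y)).
by congr mev; apply/funext => i /=; rewrite mevX.
Qed.

Lemma mev_id q : mev (fun i => 'X_i : P) q = q.
Proof. by rewrite -(mev_unique (@idfun P)). Qed.

Definition truncX (i : nat) (j : 'I_n) : P := if (i <= j)%N then 'X_j else 0.

(** The subring of polynomials in the variables of index at least [i], as the
    fixed points of an idempotent endomorphism: closure properties and
    comparisons of morphisms then need no look at monomials. *)
Definition upper (i : nat) q : Prop := mev (truncX i) q = q.

Lemma upperC i c : upper i c%:MP.
Proof. by rewrite /upper mevC alg_mpolyC. Qed.
Lemma upper1 i : upper i 1. Proof. exact: rmorph1. Qed.
Lemma upper0 i : upper i 0. Proof. exact: rmorph0. Qed.
Lemma upperX i (j : 'I_n) : (i <= j)%N -> upper i 'X_j.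
Proof. by move=> le_ij; rewrite /upper mevX /truncX le_ij. Qed.
Lemma upperD i q r : upper i q -> upper i r -> upper i (q + r).
Proof. by move=> uq ur; rewrite /upper rmorphD /= uq ur. Qed.
Lemma upperN i q : upper i q -> upper i (- q).
Proof. by move=> uq; rewrite /upper rmorphN /= uq. Qed.
Lemma upperB i q r : upper i q -> upper i r -> upper i (q - r).
Proof. by move=> uq ur; apply: upperD => //; apply: upperN. Qed.
Lemma upperM i q r : upper i q -> upper i r -> upper i (q * r).
Proof. by move=> uq ur; rewrite /upper rmorphM /= uq ur. Qed.
Lemma upperZ i c q : upper i q -> upper i (c *: q).
Proof. by move=> uq; rewrite /upper linearZ /= uq. Qed.
Lemma upperXn i q m : upper i q -> upper i (q ^+ m).
Proof. by move=> uq; rewrite /upper rmorphXn /= uq. Qed.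
Lemma upper_sum i I (r : seq I) (Q : pred I) (f : I -> P) :
  (forall j, Q j -> upper i (f j)) -> upper i (\sum_(j <- r | Q j) f j).
Proof. by move=> H; apply: big_ind => //; [exact: upper0 | exact: upperD]. Qed.

Lemma upper_ext (S : nzRingType) (f g : {rmorphism P -> S}) i q :
  upper i q -> (forall c, f c%:MP = g c%:MP) ->
  (forall j : 'I_n, (i <= j)%N -> f 'X_j = g 'X_j) -> f q = g q.
Proof.
move=> <- eC eX.
apply: (@mpoly_rmorph_ext S (f \o mev (truncX i)) (g \o mev (truncX i))) => [c|j] /=.
  by rewrite mevC alg_mpolyC.
by rewrite mevX /truncX; case: ifP => [/eX //|_]; rewrite !rmorph0.
Qed.

Lemma upper_mev_ext (A : comAlgType k) (y y' : 'I_n -> A) i q :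
  upper i q -> (forall j : 'I_n, (i <= j)%N -> y j = y' j) -> mev y q = mev y' q.
Proof.
move=> uq e; apply: upper_ext uq _ _ => [c|j /e]; first by rewrite /= !mevC.
by rewrite /= !mevX.
Qed.

Lemma upper_mev l i q (y : 'I_n -> P) : upper i q ->
  (forall j : 'I_n, (i <= j)%N -> upper l (y j)) -> upper l (mev y q).
Proof. by move=> uq uy; rewrite /upper mev_comp; apply: upper_mev_ext uq uy. Qed.

Lemma upper_zero q : upper 0 q.
Proof. by rewrite /upper -[RHS]mev_id; congr mev; apply/funext. Qed.

Lemma upper_le i j q : (j <= i)%N -> upper i q -> upper j q.
Proof.
move=> le_ji uq; rewrite -uq; apply: upper_mev (uq) _ => l le_il.
by rewrite /truncX le_il; apply: upperX; apply: leq_trans le_il.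
Qed.

Lemma upper_const q : upper n q -> q = (q@_0%MM)%:MP.
Proof.
move=> uq; have e := upper_ext (f := idfun) (g := @mpolyC n k \o mcoeff 0%MM) uq.
rewrite [LHS]e => // [c|j].
  by rewrite /= mcoeffC eqxx mulr1.
by rewrite leqNgt ltn_ord.
Qed.

Lemma vars_aboveP (i : 'I_n) q : vars_above i q <-> upper i.+1 q.
Proof.
have tX (u : 'X_{1..n}) : mev (truncX i.+1) 'X_[u] =
    if [forall j : 'I_n, (j <= i)%N ==> (u j == 0%N)] then 'X_[u] else 0.
  rewrite mpolyXE_id rmorph_prod /=; case: ifP => [/forallP H|/forallPn[j]].
    apply: eq_bigr => j _; rewrite rmorphXn /= mevX /truncX ltnNge.
    by case: leqP (H j) => //= _ /eqP->; rewrite !expr0.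
  rewrite negb_imply => /andP[le_ji uj]; rewrite (bigD1 j) //= rmorphXn /=.
  by rewrite mevX /truncX ltnNge le_ji expr0n (negPf uj) mul0r.
split=> [va|uq u qu j le_ji].
  rewrite /upper [X in mev _ X]mpolyE [RHS]mpolyE rmorph_sum /=.
  rewrite big_seq [RHS]big_seq; apply: eq_bigr => u qu.
  rewrite linearZ /= tX; case: forallP => // -[] j; apply/implyP => le_ji.
  by rewrite (va u).
have : q@_u != 0 by rewrite -mcoeff_msupp.
rewrite -uq [X in mev _ X]mpolyE rmorph_sum raddf_sum /=.
apply: contraNeq => uj; rewrite big1 // => v _; rewrite linearZ /= tX mcoeffZ.
case: forallP => [H|_]; last by rewrite mcoeff0 mulr0.
rewrite mcoeffX; case: eqVneq => [e|]; last by rewrite mulr0.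
by have := H j; rewrite e le_ji (negPf uj).
Qed.

Definition as_poly (i : 'I_n) : P -> {poly P} :=
  mmap (polyC \o @mpolyC n k) (fun j => if j == i then 'X else ('X_j)%:P).

HB.instance Definition _ i := GRing.RMorphism.copy (as_poly i)
  (mmap (polyC \o @mpolyC n k) (fun j => if j == i then 'X else ('X_j)%:P)).

Lemma as_polyC i c : as_poly i c%:MP = c%:MP%:P.
Proof. by rewrite /as_poly mmapC. Qed.

Lemma as_polyX i j : as_poly i 'X_j = if j == i then 'X else ('X_j)%:P.
Proof. by rewrite /as_poly mmapX mmap1U. Qed.

Lemma as_poly_horner i q : (as_poly i q).['X_i] = q.
Proof.
rewrite -[LHS]/((horner_eval 'X_i \o as_poly i) q).
apply: (mpoly_rmorph_ext (g := idfun)) => [c|j] /=.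
  by rewrite as_polyC horner_evalE hornerC.
rewrite as_polyX horner_evalE; case: eqP => [->|_]; first by rewrite hornerX.
by rewrite hornerC.
Qed.

Lemma as_poly_upper (i : 'I_n) q : upper i.+1 q -> as_poly i q = q%:P.
Proof.
move=> uq; apply: (upper_ext (g := polyC) uq) => [c|j lt_ij] /=.
  by rewrite as_polyC.
by rewrite as_polyX; case: eqP lt_ij => // ->; rewrite ltnn.
Qed.

Lemma as_poly_coef (i : 'I_n) q e : upper i q -> upper i.+1 (as_poly i q)`_e.
Proof.
move=> uq; rewrite /upper -coef_map; congr nth; congr polyseq.
apply: (upper_ext (f := map_poly (mev (truncX i.+1)) \o as_poly i)
  (g := as_poly i) uq) => [c|j le_ij] /=.
  by rewrite as_polyC map_polyC /= mevC alg_mpolyC.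
rewrite as_polyX; case: eqP => [_|/eqP ne]; first by rewrite map_polyX.
rewrite map_polyC /= mevX /truncX ltn_neqAle le_ij andbT.
by rewrite -(inj_eq val_inj) eq_sym in ne; rewrite ne.
Qed.

Lemma upper_expand (i : 'I_n) q : upper i q ->
  exists c : nat -> P, exists d : nat, (forall e, upper i.+1 (c e)) /\
    q = \sum_(e < d) c e * 'X_i ^+ e.
Proof.
move=> uq; exists (fun e => (as_poly i q)`_e), (size (as_poly i q)).
split=> [e|]; first exact: as_poly_coef.
by rewrite -horner_coef as_poly_horner.
Qed.

End UpperPolynomials.

Section ArtinSchreierTower.
Variables (k : fieldType) (n p : nat).
Hypothesis p_gt1 : (1 < p)%N.

(** In the variable of index [i] substituting [sigma] is a composition with a polynomial
    of positive degree, which is injective over a domain; so a relation among the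
    [sigma j] with [j >= i] has coefficients that are relations among those with
    [j > i]. *)
Lemma artin_schreier_injective (sigma : 'I_n -> {mpoly k[n]}) :
  artin_schreier_form p sigma -> injective (mev sigma).
Proof.
move=> AS; suff H : forall q, mev sigma q = 0 -> q = 0.
  by move=> q r e; apply/eqP; rewrite -subr_eq0; apply/eqP/H;
    rewrite rmorphB /= e subrr.
have up_sigma i (j : 'I_n) : (i <= j)%N -> upper i (sigma j).
  move=> le_ij; have [gam /vars_aboveP ug ->] := AS j.
  apply: upperD; last by apply: upper_le ug; apply: leqW.
  by apply: upperB; [|apply: upperXn]; apply: upperX.
suff H i : (i <= n)%N -> forall q, upper i q -> mev sigma q = 0 -> q = 0.
  by move=> q; apply: (H 0%N) => //; apply: upper_zero.
move: i; apply: down_ind => [q uq|i IH q uq sq].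
  rewrite (upper_const uq) mevC alg_mpolyC => /eqP.
  by rewrite mpolyC_eq0 => /eqP->; rewrite mpolyC0.
have comp : as_poly i (mev sigma q) =
    (map_poly (mev sigma) (as_poly i q)) \Po (as_poly i (sigma i)).
  apply: (upper_ext (f := as_poly i \o mev sigma)
    (g := comp_poly (as_poly i (sigma i)) \o (map_poly (mev sigma) \o as_poly i))
     uq) => [c|j le_ij] /=.
    rewrite mevC alg_mpolyC as_polyC map_polyC /= mevC alg_mpolyC.
    by rewrite comp_polyC.
  rewrite mevX as_polyX; case: eqP => [->|/eqP ne].
    by rewrite map_polyX comp_polyX.
  rewrite map_polyC /= mevX comp_polyC as_poly_upper //; apply: up_sigma.
  by rewrite ltn_neqAle le_ij andbT eq_sym.
have sz : (1 < size (as_poly i (sigma i)))%N.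
  have [gam /vars_aboveP ug ->] := AS i.
  rewrite rmorphD rmorphB rmorphXn /= as_polyX eqxx as_poly_upper //.
  rewrite -size_polyN opprD opprB -addrA size_polyDl size_polyXn; first exact: ltnW.
  rewrite -opprD size_polyN (leq_ltn_trans (size_polyD _ _)) //.
  rewrite size_polyX gtn_max ltnS p_gt1 /= (leq_ltn_trans (size_polyC_leq1 _)) //.
  by rewrite ltnS ltnW.
have /eqP : map_poly (mev sigma) (as_poly i q) \Po as_poly i (sigma i) = 0.
  by rewrite -comp sq rmorph0.
rewrite comp_poly_eq0 // => /eqP eq0.
rewrite -(as_poly_horner i q); suff -> : as_poly i q = 0 by rewrite horner0.
apply/polyP => e; rewrite coef0; apply: IH; first exact: as_poly_coef.
by rewrite -coef_map eq0 coef0.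
Qed.

End ArtinSchreierTower.

(** * Invariants of a tower of prime field steps *)
Section PolynomialActions.
Variables (k : fieldType) (n : nat) (G : finGroupType).
Variable F : G -> 'I_n -> {mpoly k[n]}.
Local Notation P := {mpoly k[n]}.

Definition subst (g : G) : {lrmorphism P -> P} := mev (F g).

Definition action_law : Prop :=
  (forall i, F 1%g i = 'X_i) /\ (forall g h i, F (g * h)%g i = subst h (F g i)).

Lemma substX g i : subst g 'X_i = F g i.
Proof. exact: mevX. Qed.

Lemma substC g c : subst g c%:MP = c%:MP.
Proof. by rewrite /subst /= mevC alg_mpolyC. Qed.

Lemma subst_is_act : action_law -> is_act subst.
Proof.
move=> [F1 FM]; split=> [q|g h q]; rewrite /subst /=.
  by rewrite -[RHS]mev_id; congr mev; apply/funext.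
by rewrite mev_comp; congr mev; apply/funext => i; rewrite FM.
Qed.

Lemma subst_upper (triangular : forall g (i : 'I_n), upper i.+1 (F g i - 'X_i)) g i q :
  upper i q -> upper i (subst g q).
Proof.
move=> uq; apply: upper_mev uq _ => j le_ij.
rewrite -(subrK 'X_j (F g j)); apply: upperD; last exact: upperX.
by apply: upper_le (triangular g j); apply: leqW.
Qed.

Lemma subst_fix x i q : upper i q ->
  (forall j : 'I_n, (i <= j)%N -> F x j = 'X_j) -> subst x q = q.
Proof. by move=> uq Fx; rewrite -[RHS]mev_id; apply: upper_mev_ext uq Fx. Qed.

End PolynomialActions.

Section InvariantRing.
Variables (k : fieldType) (n p : nat) (G : finGroupType).
Hypothesis chark : p \in [pchar k].
Local Notation P := {mpoly k[n]}.

(** The kernels of the actions on the polynomials in the last variables, together with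
    logarithms for the successive quotients: in this form the induction over the
    variables applies to a given action as well as to one under construction. *)
Record tower (F : G -> 'I_n -> P) (N : nat -> {group G}) (z : 'I_n -> G)
    (c : 'I_n -> G -> k) : Prop := Tower {
  tower_act : action_law F;
  tower_triangular : forall g (i : 'I_n), upper i.+1 (F g i - 'X_i);
  tower_top : N n = [set: G] :> {set G};
  tower_bottom : N 0%N = 1%g :> {set G};
  tower_step : forall i : 'I_n, prime_step (N i) (N i.+1) (z i) (c i);
  tower_shift : forall (i : 'I_n) x, x \in N i.+1 -> F x i = 'X_i + (c i x)%:MP;
  tower_fix : forall (i : nat) x, x \in N i ->
    forall j : 'I_n, (i <= j)%N -> F x j = 'X_j
}.

Variables (F : G -> 'I_n -> P) (N : nat -> {group G}) (z : 'I_n -> G)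
  (c : 'I_n -> G -> k).
Hypothesis tw : tower F N z c.

Local Notation act := (subst F).
Let actP : is_act act := subst_is_act (tower_act tw).
Let p_gt1 : (1 < p)%N := prime_gt1 (pcharf_prime chark).

Let charP : p \in [pchar P].
Proof. exact: (rmorph_pchar (@mpolyC n k)). Qed.

Lemma artin_schreier_diff (x y : P) :
  (x - x ^+ p) - (y - y ^+ p) = (x - y) - (x - y) ^+ p.
Proof.
rewrite -!(pFrobenius_autE charP) (pFrobenius_autB_comm charP); last exact: mulrC.
by rewrite !opprD !opprK addrACA.
Qed.

(** The traces are part of the induction because they determine the invariants: if [w]
    has trace 1, an invariant [v] is the trace of [v * w]. *)
Let level (i : nat) : Prop :=
  exists (sigma : 'I_n -> P) (theta : G -> k) (w : P),
  [/\ weight (N i) theta,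
      upper i w /\ relative_trace act theta w = 1,
      forall j : 'I_n, (i <= j)%N ->
        exists2 gam, upper j.+1 gam & sigma j = 'X_j - 'X_j ^+ p + gam,
      forall j : 'I_n, (i <= j)%N -> forall g, act g (sigma j) = sigma j
    & forall v, upper i v -> exists2 q, upper i q &
        relative_trace act theta v = mev sigma q].

Lemma level_top : level n.
Proof.
exists (fun=> 0), (fun g => (g == 1%g)%:R), 1.
have tr1 v : relative_trace act (fun g => (g == 1%g)%:R) v = v.
  rewrite /relative_trace (bigD1 1%g) //= eqxx scale1r actP.1 big1 ?addr0 //.
  by move=> g /negPf->; rewrite scale0r.
split=> [||j|j|v uv]; rewrite ?tr1.
- by rewrite (tower_top tw); apply: weight_setT.
- by split=> //; apply: upper1.
- by rewrite leqNgt ltn_ord.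
- by rewrite leqNgt ltn_ord.
exists v => //; rewrite [in RHS](upper_const uv) mevC alg_mpolyC.
exact: upper_const.
Qed.

(** With [t = X_i - X_i ^+ p], the differences [t g - t] are a cocycle with values in the
    polynomials in the later variables, since the Frobenius map is additive; it
    vanishes on [N i.+1], where the translations are by fixed points of the Frobenius
    map.  Splitting it corrects [t] to an invariant.  Traces of [u * X_i ^+ d] are
    reduced to [d < p] by replacing [X_i ^+ p]. *)
Lemma level_down (i : 'I_n) : level i.+1 -> level i.
Proof.
move=> [sigma [theta [w [wt [uw tr_w] sigmaAS sigma_inv traces]]]].
have st := tower_step tw i.
have fixN x q : x \in N i.+1 -> upper i.+1 q -> act x q = q.
  by move=> Nx uq; apply: subst_fix uq (tower_fix tw Nx).
pose t : P := 'X_i - 'X_i ^+ p; pose e g := act g t - t.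
have eE g : e g = (F g i - 'X_i) - (F g i - 'X_i) ^+ p.
  by rewrite /e /t rmorphB rmorphXn /= !substX artin_schreier_diff.
have e0 x : x \in N i.+1 -> e x = 0.
  move=> Nx; rewrite eE (tower_shift tw Nx) [X in X - _ ^+ _]addrAC
    ['X_i + _ - _]addrAC subrr add0r.
  have [m ->] := step_nat st Nx.
  by rewrite rmorph_nat -(pFrobenius_autE charP) pFrobenius_aut_nat subrr.
have cocyc g h : e (g * h)%g = act h (e g) + e h.
  by rewrite /e actP.2; move: (t) => s; rewrite rmorphB /= addrA subrK.
pose b := \sum_g theta g *: (act g w * e g).
have db : forall h, act h b - b = - e h.
  by apply: (cocycle_split actP wt _ tr_w cocyc e0) => x Nx; apply: fixN.
have ub : upper i.+1 b.
  apply: upper_sum => g _; apply/upperZ/upperM.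
    by apply: subst_upper => //; apply: (tower_triangular tw).
  by rewrite eE; apply: upperB; [|apply: upperXn]; apply: (tower_triangular tw).
pose sigma' j := if j == i then t + b else sigma j.
have sigma'E (j : 'I_n) : (i < j)%N -> sigma' j = sigma j.
  by move=> lt_ij; rewrite /sigma'; case: eqP lt_ij => // ->; rewrite ltnn.
have inv_i g : act g (sigma' i) = sigma' i.
  rewrite /sigma' eqxx rmorphD /=; apply/eqP.
  rewrite -subr_eq0 opprD addrACA -/(e g) addrC; apply/eqP.
  by rewrite db addNr.
have z_w : act (z i) w = w by apply: fixN; rewrite ?(step_mem st).
have z_X : act (z i) 'X_i = 'X_i + 1.
  by rewrite substX (tower_shift tw) ?(step_mem st) // (step_gen st) mpolyC1.
exists sigma', (refine_weight p (z i) theta), (- (w * 'X_i ^+ p.-1)).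
split.
- exact: weight_step st wt.
- split.
    by apply/upperN/upperM; [apply: upper_le uw | apply/upperXn/upperX].
  exact: trace_one_refine.
- move=> j; rewrite leq_eqVlt => /predU1P[eq_ij|lt_ij]; last first.
    by rewrite sigma'E //; apply: sigmaAS.
  by rewrite -(val_inj eq_ij) /sigma' eqxx; exists b.
- move=> j; rewrite leq_eqVlt => /predU1P[eq_ij|lt_ij].
    by rewrite -(val_inj eq_ij).
  by rewrite sigma'E //; apply: sigma_inv.
(* Relative traces of the polynomials of this level are polynomials in sigma'. *)
pose good v := exists2 q, upper i q &
  relative_trace act (refine_weight p (z i) theta) v = mev sigma' q.
have goodD u v : good u -> good v -> good (u + v).
  move=> [q uq eq] [r ur er]; exists (q + r); first exact: upperD.
  by rewrite relative_traceD eq er rmorphD.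
have good_sigma v : good v -> good (- sigma' i * v).
  move=> [q uq eq]; exists (- 'X_i * q).
    by apply: upperM => //; apply/upperN/upperX.
  rewrite relative_traceM => [|g]; last by rewrite rmorphN /= inv_i.
  by rewrite eq rmorphM rmorphN /= mevX.
have good_monomial d u : upper i.+1 u -> good (u * 'X_i ^+ d).
  elim/ltn_ind: d u => d IH u uu; case: (ltnP d p) => [lt_dp|le_pd].
    have [q uq eq] := traces u uu; exists (power_sum k p d *: q).
      by apply: upperZ; apply: upper_le uq.
    rewrite (relative_trace_refine chark actP) // ?eq; last first.
      by apply: fixN; rewrite ?(step_mem st).
    rewrite linearZ /=; congr (_ *: _); apply: upper_mev_ext uq _ => j lt_ij.
    by rewrite sigma'E.
  have -> : u * 'X_i ^+ d = u * 'X_i ^+ (d - p).+1 +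
      (- sigma' i * (u * 'X_i ^+ (d - p)) + (u * b) * 'X_i ^+ (d - p)).
    rewrite -[in LHS](subnKC le_pd) exprD exprS.
    have -> : 'X_i ^+ p = 'X_i - sigma' i + b.
      by rewrite /sigma' eqxx /t opprD !opprB addrA subrK addrCA subrr addr0.
    rewrite !(mulrDl, mulrDr) -!addrA; congr (_ + (_ + _)).
      by rewrite !mulNr mulrN mulrCA.
    by rewrite mulrA.
  have lt_d : (d - p < d)%N.
    by rewrite ltn_subrL (leq_trans _ le_pd) ltnW.
  apply: (goodD); first apply: IH => //.
    by rewrite -addn2 -(leq_add2r p) addnAC subnK // leq_add2l.
  by apply: goodD; [apply: good_sigma|]; apply: IH => //; apply: upperM.
move=> v uv; have [co [d [uco ->]]] := upper_expand uv.
rewrite -/(good _); apply: (big_ind good) => // [|l _]; last exact: good_monomial.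
exists 0; first exact: upper0.
by rewrite rmorph0 /relative_trace big1 // => g _; rewrite rmorph0 scaler0.
Qed.

Theorem tower_invariants : exists sigma : 'I_n -> P,
  [/\ artin_schreier_form p sigma,
      exists w, \sum_g act g w = 1
    & forall v, (forall g, act g v = v) <-> exists q, v = mev sigma q].
Proof.
have [sigma [theta [w [wt [_ tr_w] AS inv traces]]]] :=
  down_ind level_top level_down (leq0n n).
have trE v : relative_trace act theta v = \sum_g act g v.
  apply: eq_bigr => g _; have := wt g.
  by rewrite (tower_bottom tw) big_set1 mul1g => ->; rewrite scale1r.
exists sigma; split.
- by move=> i; have [//|gam ug ->] := AS i; exists gam => //; apply/vars_aboveP.
- by exists w; rewrite -trE.
move=> v; split=> [v_inv|[q ->] g].
  have [|q _ e] := traces (v * w); first exact: upper_zero.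
  by exists q; rewrite -e relative_traceM // tr_w mulr1.
by rewrite mev_comp; congr mev; apply/funext => i; apply: inv.
Qed.

End InvariantRing.

(** * Algebras with a group action and the universal algebra *)
Lemma quotient_lift (K : comNzRingType) (B : comAlgType K) (A : comNzRingType)
    (m : nat) (s : 'I_m -> B) (proper : 1 \notin ideal_gen s)
    (f : {rmorphism B -> A}) : (forall i, f (s i) = 0) ->
  exists phi : {rmorphism alg_quot proper -> A},
    forall x, phi (qpi proper x) = f x.
Proof.
move=> fs; pose h (x : alg_quot proper) : A := f (qrepr x).
have hpi x : h (qpi proper x) = f x.
  apply/eqP; rewrite -subr_eq0 -rmorphB; apply/eqP.
  have /qpi_eq/asboolP[c ->] : qpi proper (qrepr (qpi proper x)) = qpi proper x.
    exact: qreprK.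
  by rewrite rmorph_sum big1 // => i _; rewrite rmorphM /= fs mulr0.
have hB : zmod_morphism h.
  by move=> x y; rewrite -(qreprK x) -(qreprK y) -rmorphB !hpi rmorphB.
have hM : monoid_morphism h.
  split; first by rewrite -(rmorph1 (qpi proper)) hpi rmorph1.
  by move=> x y; rewrite -(qreprK x) -(qreprK y) -rmorphM !hpi rmorphM.
pose hAdd := GRing.isZmodMorphism.Build _ _ h hB.
pose hMul := GRing.isMonoidMorphism.Build _ _ h hM.
pose phi : {rmorphism alg_quot proper -> A} := HB.pack h hAdd hMul.
by exists phi => x; rewrite -hpi.
Qed.

Lemma scalable_lrmorphism (K : nzRingType) (A B : lalgType K)
    (f : {rmorphism A -> B}) : scalable f ->
  exists h : {lrmorphism A -> B}, forall x, h x = f x.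
Proof.
move=> fZ; pose g x := f x.
have gB : zmod_morphism g by move=> x y; apply: rmorphB.
have gM : monoid_morphism g by split=> [|x y]; [apply: rmorph1 | apply: rmorphM].
pose hB := GRing.isZmodMorphism.Build _ _ g gB.
pose hM := GRing.isMonoidMorphism.Build _ _ g gM.
pose hZ := GRing.isScalable.Build K A B *:%R g fZ.
pose h : {lrmorphism A -> B} := HB.pack g hB hM hZ.
by exists h.
Qed.

Section GAlgebraMorphisms.
Variables (k : fieldType) (G : finGroupType) (A : comAlgType k).
Variable to : {action G &-> A}.

(** The proof that [to] is an action by algebra morphisms is a dummy argument, through
    which the morphism structure of [galg_fun] is inferred. *)
Definition galg_fun of galg_action to := fun (g : G) (x : A) => to x g.
Hypothesis toP : galg_action to.

HB.instance Definition _ g :=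
  GRing.isLinear.Build k A A *:%R (galg_fun toP g) (toP g).1.
HB.instance Definition _ g :=
  GRing.isMonoidMorphism.Build A A (galg_fun toP g) (toP g).2.

Definition galg_act (g : G) : {lrmorphism A -> A} := galg_fun toP g.

Lemma galg_is_act : is_act galg_act.
Proof.
have [to_inj toM] : is_action [set: G] to by case: (to).
split=> [a|g h a]; last by apply: toM; rewrite inE.
by apply: (to_inj 1%g); rewrite [LHS]/= -/(to a 1%g) -toM ?inE ?mulg1.
Qed.

End GAlgebraMorphisms.

Section DkUniversal.
Variables (k : fieldType) (G : finGroupType).

Definition dact : G -> {lrmorphism Dk k G -> Dk k G} := galg_act (@Dact_galg k G).

Definition dX (g : G) : Dk k G := Dpi k G (regX k g).

Lemma dact_dX g h : dact h (dX g) = dX (g * h)%g.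
Proof. by rewrite /dact /= /galg_fun /= Dact_pi reg_actX. Qed.

Lemma sum_dX : \sum_g dX g = 1.
Proof.
rewrite /dX -rmorph_sum -(rmorph1 (Dpi k G)); apply/qpi_eq/asboolP.
exists (fun=> 1); rewrite big_ord1 mul1r /reg_alpha addrC; congr (_ + _).
Qed.

Lemma Dk_ext (A : comAlgType k) (f h : {lrmorphism Dk k G -> A}) :
  (forall g, f (dX g) = h (dX g)) -> f =1 h.
Proof.
move=> e x; rewrite -(DreprK x).
rewrite -[LHS]/((f \o Dpi k G) _) -[RHS]/((h \o Dpi k G) _).
apply: mpoly_rmorph_ext => [c|i] /=; first by rewrite -alg_mpolyC !linearZ !rmorph1.
by have := e (enum_val i); rewrite /dX /regX enum_valK.
Qed.

Lemma Dk_universal (A : comAlgType k) (act : G -> {lrmorphism A -> A}) v :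
  is_act act -> \sum_g act g v = 1 ->
  exists theta : {lrmorphism Dk k G -> A},
    (forall g, theta (dX g) = act g v) /\
    (forall x g, theta (dact g x) = act g (theta x)).
Proof.
move=> actP tr1.
pose f : {lrmorphism symreg k G -> A} := mev (fun i => act (enum_val i) v).
have fX g : f (regX k g) = act g v by rewrite /f /= mevX enum_rankK.
have f0 (i : 'I_1) : f (reg_alpha k G) = 0.
  rewrite rmorphD rmorphN1 rmorph_sum /=.
  by under eq_bigr do rewrite fX; rewrite tr1 addNr.
have [phi phiE] := quotient_lift (reg_alpha_proper k G) f0.
have phiZ : scalable (phi : Dk k G -> A).
  move=> a x; rewrite -(DreprK x); move: (Drepr x) => y.
  have -> : a *: Dpi k G y = Dpi k G (a *: y) by rewrite linearZ.
  rewrite [LHS]phiE [LHS](linearZ_LR f); congr (_ *: _); apply/esym/phiE.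
have [theta thetaE] := scalable_lrmorphism phiZ.
have thX g : theta (dX g) = act g v by rewrite thetaE [LHS]phiE; apply: fX.
exists theta; split=> // x g.
apply: (Dk_ext (f := theta \o dact g) (h := act g \o theta)) => h.
rewrite -[LHS]/(theta (dact g (dX h))) -[RHS]/(act g (theta (dX h))).
by rewrite dact_dX !thX actP.2.
Qed.

End DkUniversal.
Arguments dact {k G} g.

(** * The structure theorem by Galois descent *)
Section EmbeddedPolynomials.
Variables (k : fieldType) (G : finGroupType) (n : nat).
Variables (y : 'I_n -> Dk k G) (F : G -> 'I_n -> {mpoly k[n]}).
Hypothesis mev_inj : injective (mev y).
Hypothesis y_stable : forall g i, dact g (y i) = mev y (F g i).

Lemma embedded_equivariant g q : dact g (mev y q) = mev y (subst F g q).
Proof.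
rewrite [LHS]mev_comp [RHS]mev_comp; congr (mev _ q); apply/funext => i.
exact: y_stable.
Qed.

Lemma embedded_invariant q :
  ginvariant (Dact k G) (mev y q) <-> forall g, subst F g q = q.
Proof.
split=> H g; first by apply: mev_inj; rewrite -embedded_equivariant; apply: H.
by rewrite -[LHS]/(dact g (mev y q)) embedded_equivariant H.
Qed.

Lemma embedded_invariants (sigma : 'I_n -> {mpoly k[n]}) :
  (forall q, (forall g, subst F g q = q) <-> exists q', q = mev sigma q') ->
  forall u, (in_subalg y u /\ ginvariant (Dact k G) u) <->
    in_subalg (fun i => mev y (sigma i)) u.
Proof.
move=> inv u.
have mev_sigma q : mev (fun i => mev y (sigma i)) q = mev y (mev sigma q).
  by rewrite [RHS]mev_comp.
split=> [[[q ->] /embedded_invariant/inv[q' ->]]|[q' ->]].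
  by exists q'; rewrite mev_sigma.
rewrite mev_sigma; split; first by exists (mev sigma q').
by apply/embedded_invariant/inv; exists q'.
Qed.

End EmbeddedPolynomials.

Section UniversalSubalgebraAction.
Variables (k : fieldType) (G : finGroupType) (n : nat).
Variables (y : 'I_n -> Dk k G) (F : G -> 'I_n -> {mpoly k[n]})
  (sigma : 'I_n -> {mpoly k[n]}).
Hypothesis U : universal_subalg y F sigma.
Local Notation P := {mpoly k[n]}.

Let mev_inj : injective (mev y) := us_alg_indep U.

Lemma universal_equivariant g (q : P) : dact g (mev y q) = mev y (subst F g q).
Proof. exact: embedded_equivariant (us_stable U) g q. Qed.

Lemma universal_act_law : action_law F.
Proof.
have [D1 DM] := galg_is_act (@Dact_galg k G).
split=> [i|g h i]; apply: mev_inj.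
  by rewrite mevX -(us_stable U); apply: D1.
by rewrite -universal_equivariant -!(us_stable U); apply: DM.
Qed.

Lemma universal_trace_one : exists v : P, \sum_g subst F g v = 1.
Proof.
have [||u [v ->] tr] := us_trace_surjective U (u := 1).
- by exists 1; rewrite rmorph1.
- by move=> g; exact: (rmorph1 (dact g)).
exists v; apply: mev_inj; rewrite rmorph1 -[RHS]tr rmorph_sum.
by apply: eq_bigr => g _; rewrite -[LHS]universal_equivariant.
Qed.

Lemma universal_invariants (q : P) :
  (forall g, subst F g q = q) <-> exists q', q = mev sigma q'.
Proof.
rewrite -(embedded_invariant mev_inj (us_stable U)); split=> [H|[q' ->]].
  have [|q' e] := (us_invariants U (mev y q)).1; first by split=> //; exists q.
  by exists q'; apply: mev_inj; apply: etrans e _; rewrite [RHS]mev_comp.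
apply: ((us_invariants U _).2 _).2; exists q'.
by rewrite [LHS]mev_comp.
Qed.

End UniversalSubalgebraAction.

Section BaseChange.
Variables (k : fieldType) (G : finGroupType) (n : nat) (R : comAlgType k).
Variable F : G -> 'I_n -> {mpoly k[n]}.

Lemma base_changeC c : base_change R (m := n) c%:MP = (c%:A)%:MP.
Proof. by rewrite /base_change map_mpolyC. Qed.

Lemma base_changeX i : base_change R (m := n) 'X_i = 'X_i.
Proof. by rewrite /base_change map_mpolyX. Qed.

Definition scalar_ext : {rmorphism {mpoly k[n]} -> {mpoly R[n]}} :=
  map_mpoly (in_alg R).

Definition subst_ext (g : G) : {rmorphism {mpoly R[n]} -> {mpoly R[n]}} :=
  mev (fun i => base_change R (F g i)).

Lemma subst_extC g c : subst_ext g c%:MP = c%:MP.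
Proof. by rewrite /subst_ext /= mevC alg_mpolyC. Qed.

Lemma subst_scalar_ext g q :
  subst_ext g (scalar_ext q) = scalar_ext (subst F g q).
Proof.
apply: (mpoly_rmorph_ext (f := subst_ext g \o scalar_ext)
  (g := scalar_ext \o subst F g)) => [c|i].
  rewrite -[LHS]/(subst_ext g (base_change R c%:MP)).
  rewrite -[RHS]/(base_change R (subst F g c%:MP)).
  by rewrite substC !base_changeC subst_extC.
rewrite -[LHS]/(subst_ext g (base_change R 'X_i)) base_changeX /= mevX.
by rewrite mevX.
Qed.

End BaseChange.

Section GaloisDescent.
Variables (k : fieldType) (G : finGroupType) (n : nat) (R : comAlgType k).
Local Notation P := {mpoly k[n]}.
Local Notation Q := {mpoly R[n]}.
Variables (act : G -> {lrmorphism P -> P}) (act_ext : G -> {rmorphism Q -> Q}).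
Variables (ext : {rmorphism P -> Q}) (sigma : 'I_n -> P).
Hypothesis actP : is_act act.
Hypothesis act_ext1 : forall x, act_ext 1%g x = x.
Hypothesis act_extC : forall g c, act_ext g c%:MP = c%:MP.
Hypothesis extE : forall q, ext q = base_change R q.
Hypothesis act_ext_ext : forall g q, act_ext g (ext q) = ext (act g q).
Hypothesis invariants : forall q,
  (forall g, act g q = q) <-> exists q', q = mev sigma q'.
Variable s : seq (P * P).
Hypothesis coordinates : forall g, pairing act s g = (g == 1%g)%:R.

Definition trace_ext (x : Q) : Q := \sum_g act_ext g x.

(** Exchange the sum over the coordinates with the sum over [G]: only the term of the
    identity survives. *)
Lemma coordinates_expand (x : Q) :
  x = \sum_(ab <- s) ext ab.1 * trace_ext (x * ext ab.2).
Proof.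
under eq_bigr do rewrite mulr_sumr.
rewrite exchange_big /=.
transitivity (\sum_g act_ext g x * ext (pairing act s g)).
  rewrite (bigD1 1%g) //= coordinates eqxx rmorph1 mulr1 act_ext1.
  rewrite [X in _ + X]big1 ?addr0 // => g g1.
  by rewrite coordinates (negPf g1) rmorph0 mulr0.
apply: eq_bigr => g _; rewrite rmorph_sum mulr_sumr; apply: eq_bigr => ab _.
by rewrite !rmorphM /= act_ext_ext mulrCA.
Qed.

Variables (r : 'I_n -> R) (proper : 1 \notin ideal_gen (fiber_eqs sigma r)).

Lemma fiber_invariant_const q : (forall g, act g q = q) ->
  exists c : R, qpi proper (ext q) = qpi proper c%:MP.
Proof.
move/invariants => [q' ->]; exists (mev r q').
apply: (mpoly_rmorph_ext (f := qpi proper \o (ext \o mev sigma))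
  (g := qpi proper \o (@mpolyC n R \o mev r))) => [c|i].
  rewrite -[LHS]/(qpi proper (ext (mev sigma c%:MP))).
  rewrite -[RHS]/(qpi proper (mev r c%:MP)%:MP).
  by rewrite !mevC alg_mpolyC extE base_changeC.
rewrite -[LHS]/(qpi proper (ext (mev sigma 'X_i))).
rewrite -[RHS]/(qpi proper (mev r 'X_i)%:MP) !mevX extE.
apply/qpi_eq/asboolP; exists (fun j => (j == i)%:R).
rewrite (bigD1 i) //= eqxx mul1r big1 ?addr0 // => j /negPf->.
by rewrite mul0r.
Qed.

(** By linearity over [R] the trace is needed only for monomials, whose traces are
    invariants defined over [k]. *)
Lemma fiber_trace_const (x : Q) :
  exists c : R, qpi proper (trace_ext x) = qpi proper c%:MP.
Proof.
have trD (a b : Q) : trace_ext (a + b) = trace_ext a + trace_ext b.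
  by rewrite /trace_ext -big_split; apply: eq_bigr => g _; rewrite rmorphD.
rewrite (mpolyE x); apply: (big_ind (fun x => exists c : R,
  qpi proper (trace_ext x) = qpi proper c%:MP)) => [|a b [c ec] [d ed]|u _].
- by exists 0; rewrite /trace_ext big1 ?mpolyC0 // => g _; rewrite rmorph0.
- by exists (c + d); rewrite trD mpolyCD !rmorphD /= ec ed.
have [|c ec] := @fiber_invariant_const (\sum_g act g 'X_[u]).
  move=> h; rewrite rmorph_sum [RHS](reindex_inj (mulIg h)) /=.
  by apply: eq_bigr => g _; rewrite actP.2.
exists (x@_u * c); rewrite mpolyCM rmorphM /= -[X in _ * X]ec.
rewrite -rmorphM; congr (qpi _ _); rewrite rmorph_sum mulr_sumr.
apply: eq_bigr => g _; rewrite -mul_mpolyC rmorphM /= act_extC.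
by rewrite -act_ext_ext extE /base_change map_mpolyX.
Qed.

Variables (A : comAlgType k) (actA : G -> {lrmorphism A -> A}).
Variables (iota : {lrmorphism R -> A}) (f : {rmorphism Q -> A}).
Hypothesis iota_inj : injective iota.
Hypothesis fC : forall c, f c%:MP = iota c.
Hypothesis f_act : forall g x, f (act_ext g x) = actA g (f x).
Hypothesis f_fiber : forall i, f (fiber_eqs sigma r i) = 0.
Hypothesis A_invariants : forall a, (forall g, actA g a = a) -> exists c, a = iota c.
Hypothesis A_actP : is_act actA.

(** All the traces of [x * ext ab.2] are constants modulo the relations, and these
    constants vanish because [R] embeds into [A]. *)
Lemma descent_kernel x : f x = 0 -> qpi proper x = 0.
Proof.
move=> fx0; rewrite (coordinates_expand x) rmorph_sum big1 // => ab _.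
rewrite rmorphM; have [c ec] := fiber_trace_const (x * ext ab.2).
suff c0 : c = 0.
  have e0 : qpi proper (trace_ext (x * ext ab.2)) = 0.
    by rewrite ec c0 mpolyC0 rmorph0.
  by rewrite [X in _ * X]e0 mulr0.
apply: iota_inj; rewrite rmorph0 -fC.
have [phi phiE] := quotient_lift proper f_fiber.
rewrite -phiE -ec phiE /trace_ext rmorph_sum big1 // => g _.
by rewrite f_act rmorphM fx0 mul0r rmorph0.
Qed.

(** The images of the coordinates expand [a] with coefficients that are traces in [A],
    hence elements of [R]. *)
Lemma descent_surjective a : exists x, f x = a.
Proof.
have tr_inv (b : A) : exists c, \sum_g actA g b = iota c.
  apply: A_invariants => h; rewrite rmorph_sum [RHS](reindex_inj (mulIg h)).
  by apply: eq_bigr => g _; rewrite A_actP.2.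
have [c cE] := choice (fun b => tr_inv (a * f (ext b))).
exists (\sum_(ab <- s) ext ab.1 * (c ab.2)%:MP).
rewrite rmorph_sum; under eq_bigr do rewrite rmorphM /= fC -cE mulr_sumr.
rewrite exchange_big /=.
transitivity (\sum_g actA g a * f (ext (pairing act s g))).
  apply: eq_bigr => g _; rewrite !rmorph_sum mulr_sumr; apply: eq_bigr => ab _.
  by rewrite !rmorphM /= mulrCA -f_act act_ext_ext.
rewrite (bigD1 1%g) //= coordinates eqxx !rmorph1 mulr1 A_actP.1 big1 ?addr0 //.
by move=> g /negPf g1; rewrite coordinates g1 !rmorph0 mulr0.
Qed.

End GaloisDescent.

Section StructureTheorem.
Variables (k : fieldType) (p n : nat) (G : finGroupType).
Hypotheses (chark : p \in [pchar k]) (cardG : #|G| = (p ^ n)%N).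

Lemma pgroup_setT : (p.-group [set: G])%g.
Proof.
rewrite /pgroup cardsT cardG pnatX pnat_id ?orTb //.
exact: (pcharf_prime chark).
Qed.

Theorem universal_structure (y : 'I_n -> Dk k G) (F : G -> 'I_n -> {mpoly k[n]})
    (sigma : 'I_n -> {mpoly k[n]}) (R A : comAlgType k) (to : {action G &-> A})
    (iota : {lrmorphism R -> A}) :
  universal_subalg y F sigma -> galg_action to -> trace_surjective to ->
  injective iota -> (forall a, ginvariant to a <-> exists c, a = iota c) ->
  exists (r : 'I_n -> R) (proper : 1 \notin ideal_gen (fiber_eqs sigma r))
    (phi : {rmorphism alg_quot proper -> A}),
    [/\ bijective phi,
        forall c : R, phi (qpi proper (mpolyC n c)) = iota c
      & forall (P : {mpoly R[n]}) (g : G),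
          phi (qpi proper (poly_act F P g)) = to (phi (qpi proper P)) g].
Proof.
move=> U toP tr_surj iota_inj inv_iota.
pose act := galg_act toP; have actP : is_act act := galg_is_act toP.
have [v tr_v] : exists v, \sum_g act g v = 1.
  by apply: tr_surj => g; exact: (rmorph1 (act g)).
have [theta [_ thE]] := Dk_universal actP tr_v.
pose yA := theta \o y.
have yAE q : mev yA q = theta (mev y q) by rewrite [RHS]mev_comp.
have yA_act g q : mev yA (subst F g q) = act g (mev yA q).
  by rewrite !yAE -(universal_equivariant U) thE.
have sigma_const i : exists c, mev yA (sigma i) = iota c.
  apply/inv_iota => g; rewrite -[LHS]/(act g (mev yA (sigma i))) -yA_act.
  rewrite ((universal_invariants U _).2 _) //.
  by exists 'X_i; rewrite mevX.
have [r rE] := choice sigma_const.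
pose f : {rmorphism {mpoly R[n]} -> A} := mmap iota yA.
have fC c : f c%:MP = iota c by rewrite /f /= mmapC.
have fX i : f 'X_i = yA i by rewrite /f /= mmapX mmap1U.
have f_ext q : f (scalar_ext n R q) = mev yA q.
  apply: (mpoly_rmorph_ext (f := f \o scalar_ext n R) (g := mev yA)) => [c|i].
    rewrite -[LHS]/(f (base_change R c%:MP)) base_changeC fC [RHS]mevC.
    by rewrite linearZ rmorph1.
  by rewrite -[LHS]/(f (base_change R 'X_i)) base_changeX fX [RHS]mevX.
have f_act g x : f (subst_ext R F g x) = act g (f x).
  apply: (mpoly_rmorph_ext (f := f \o subst_ext R F g) (g := act g \o f)) => [c|i].
    rewrite -[LHS]/(f (subst_ext R F g c%:MP)) -[RHS]/(act g (f c%:MP)).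
    rewrite subst_extC fC; have /inv_iota H : exists c', iota c = iota c' by exists c.
    by rewrite [RHS]H.
  rewrite -[LHS]/(f (subst_ext R F g 'X_i)) -[RHS]/(act g (f 'X_i)).
  by rewrite fX -(mevX yA) -yA_act substX -f_ext /= mevX.
have f_fiber i : f (fiber_eqs sigma r i) = 0.
  by rewrite rmorphB /= -[mmap _ _ _]/(f (scalar_ext n R (sigma i))) f_ext
    rE -[mmap _ _ _]/(f (r i)%:MP) fC subrr.
have proper : 1 \notin ideal_gen (fiber_eqs sigma r).
  apply/negP => /asboolP[c /(congr1 f)]; rewrite rmorph1 rmorph_sum big1.
    by move/eqP; rewrite oner_eq0.
  by move=> i _; rewrite rmorphM f_fiber mulr0.
have [phi phiE] := quotient_lift proper f_fiber.
exists r, proper, phi.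
have [v0 tr_v0] := universal_trace_one U.
have lawF := universal_act_law U; have subP := subst_is_act lawF.
have inv_sigma := universal_invariants U.
have [s sE] := galois_coordinates chark pgroup_setT subP tr_v0.
have ext1 x : subst_ext R F 1%g x = x.
  apply: (mpoly_rmorph_ext (f := subst_ext R F 1%g) (g := idfun)) => [c|i].
    exact: subst_extC.
  by rewrite /= mevX lawF.1 base_changeX.
have extC := @subst_extC k G n R F.
have extE q : scalar_ext n R q = base_change R q by [].
have ext_ext := @subst_scalar_ext k G n R F.
have A_inv a : (forall g, act g a = a) -> exists c, a = iota c.
  by move=> H; apply/inv_iota => g; apply: H.
split=> [|c|x g].
- have [h hE] := choice (descent_surjective ext_ext sE fC f_act A_inv actP).
  exists (qpi proper \o h) => [x|a] /=; last by rewrite phiE hE.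
  have ker := descent_kernel subP ext1 extC extE ext_ext inv_sigma sE
    proper iota_inj fC f_act f_fiber.
  rewrite -(qreprK x) phiE; apply/eqP; rewrite -subr_eq0 -rmorphB; apply/eqP.
  by apply: ker; rewrite rmorphB hE subrr.
- by rewrite phiE fC.
by rewrite !phiE; apply: f_act.
Qed.

End StructureTheorem.

(** * Artin-Schreier generators of the invariant ring *)
Section KernelTower.
Variables (k : fieldType) (p n : nat) (G : finGroupType).
Hypotheses (chark : p \in [pchar k]) (cardG : #|G| = (p ^ n)%N).
Variable F : G -> 'I_n -> {mpoly k[n]}.
Hypotheses (lawF : action_law F) (steps : prime_field_steps F).
Hypothesis triangular : forall g (i : 'I_n), upper i.+1 (F g i - 'X_i).
Hypothesis faithful : forall g, (forall i, F g i = 'X_i) -> g = 1%g.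

Let p_gt1 : (1 < p)%N := prime_gt1 (pcharf_prime chark).

Definition level_kernel_set (i : nat) : {set G} :=
  [set g | [forall j : 'I_n, (i <= j)%N ==> (F g j == 'X_j)]].

Lemma level_kernelP i g : reflect (forall j : 'I_n, (i <= j)%N -> F g j = 'X_j)
  (g \in level_kernel_set i).
Proof.
rewrite inE; apply: (iffP forallP) => H j.
  by move=> le_ij; apply/eqP; apply: (implyP (H j)).
by apply/implyP => /H ->.
Qed.

Lemma level_kernel_group_set i : group_set (level_kernel_set i).
Proof.
apply/group_setP; split=> [|g h /level_kernelP Fg /level_kernelP Fh].
  by apply/level_kernelP => j _; apply: lawF.1.
apply/level_kernelP => j le_ij.
by rewrite lawF.2 Fg // substX Fh.
Qed.

Definition level_kernel i : {group G} := group (level_kernel_group_set i).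

Definition level_shift (i : 'I_n) (x : G) : k := (F x i - 'X_i)@_0%MM.

Lemma level_shift_nat (i : 'I_n) x : x \in level_kernel i.+1 ->
  exists m : nat, F x i = 'X_i + m%:R /\ level_shift i x = m%:R.
Proof.
move/level_kernelP => Fx; have [m e] := steps Fx; exists m; split=> //.
by rewrite /level_shift e addrAC subrr add0r rmorph_nat.
Qed.

Lemma level_shiftE (i : 'I_n) x : x \in level_kernel i.+1 ->
  F x i = 'X_i + (level_shift i x)%:MP.
Proof. by case/level_shift_nat=> m [-> ->]; rewrite rmorph_nat. Qed.

Lemma level_shiftM (i : 'I_n) :
  {in level_kernel i.+1 &, forall x y,
    level_shift i (x * y)%g = level_shift i x + level_shift i y}.
Proof.
move=> x y Nx Ny; have Nxy := groupM Nx Ny.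
have := level_shiftE Nxy.
rewrite lawF.2 (level_shiftE Nx) rmorphD /= -/(subst F y) substX substC.
rewrite (level_shiftE Ny) -addrA => /addrI.
by rewrite -mpolyCD addrC => /(congr1 (mcoeff 0%MM)); rewrite !mpolyCK.
Qed.

Lemma level_shift_ker (i : 'I_n) x : x \in level_kernel i.+1 ->
  (level_shift i x = 0 <-> x \in level_kernel i).
Proof.
move=> Nx; split=> [e|/level_kernelP Fx]; last first.
  by rewrite /level_shift Fx // subrr mcoeff0.
apply/level_kernelP => j; rewrite leq_eqVlt => /predU1P[/val_inj <-|].
  by rewrite level_shiftE // e mpolyC0 addr0.
exact/level_kernelP.
Qed.

Lemma level_kernel_sub i : level_kernel i \subset level_kernel i.+1.
Proof.
by apply/subsetP => x /level_kernelP Fx; apply/level_kernelP => j /ltnW /Fx.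
Qed.

Lemma level_step_or_eq (i : 'I_n) :
  (exists z, prime_step (level_kernel i) (level_kernel i.+1) z (level_shift i))
  \/ #|level_kernel i.+1| = #|level_kernel i|.
Proof.
case: (boolP (level_kernel i.+1 \subset level_kernel i)) =>
    [sub|/subsetPn[x Nx nx]].
  by right; apply/eqP; rewrite eqn_leq !subset_leq_card ?level_kernel_sub.
left; have [m [_ cx]] := level_shift_nat Nx.
have nz : (m%:R : k) != 0.
  by apply: contraNneq nx => m0; apply/(level_shift_ker Nx); rewrite cx.
have cX l : level_shift i (x ^+ l)%g = (l * m)%:R.
  elim: l => [|l IH]; first by rewrite expg0; apply/level_shift_ker; exact: group1.
  by rewrite expgS level_shiftM ?groupX // IH cx mulSn natrD.
(* The inverse of m modulo p is its power of exponent p - 2. *)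
exists (x ^+ (m ^ p.-2))%g; split.
- exact: level_kernel_sub.
- exact: groupX.
- rewrite cX -expnSr natrX; apply: (mulfI nz); rewrite mulr1 -exprS.
  by case: p p_gt1 chark => [|[|q]] // _ chq; exact: nat_expp chq m.
- exact: level_shiftM.
- by move=> y /level_shift_nat[l [_ ->]]; exists l.
exact: level_shift_ker.
Qed.

Lemma level_kernel_top : level_kernel n = [set: G] :> {set G}.
Proof.
apply/setP => g; rewrite [RHS]inE; apply/level_kernelP => j.
by rewrite leqNgt ltn_ord.
Qed.

Lemma level_kernel_bottom : level_kernel 0 = 1%g :> {set G}.
Proof.
apply/trivgP/subsetP => g /level_kernelP Fg; apply/set1P/faithful => i.
exact: Fg.
Qed.

(** Each level contributes at most a factor [p] to the order of [G], so the order
    [p ^ n] leaves no room for a level at which nothing moves. *)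
Lemma level_step_exists (i : 'I_n) :
  exists z, prime_step (level_kernel i) (level_kernel i.+1) z (level_shift i).
Proof.
have [//|stuck] := level_step_or_eq i.
have grow (j : 'I_n) : (#|level_kernel j.+1| <= p * #|level_kernel j|)%N.
  have [[z /(step_card chark) ->] //|->] := level_step_or_eq j.
  by rewrite leq_pmull // ltnW.
have below j : (j <= n)%N -> (#|level_kernel j| <= p ^ j)%N.
  elim: j => [|j IH] lt_jn; first by rewrite level_kernel_bottom cards1.
  rewrite (leq_trans (grow (Ordinal lt_jn))) // expnS leq_mul2l IH ?orbT //.
  exact: ltnW.
have above d : (i.+1 + d <= n)%N -> (#|level_kernel (i.+1 + d)| <= p ^ (i + d))%N.
  elim: d => [|d IH]; first by rewrite !addn0 stuck => _; apply/below/ltnW.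
  rewrite !addnS => lt_n; rewrite (leq_trans (grow (Ordinal lt_n))) // expnS.
  by rewrite leq_mul2l IH ?orbT // ltnW.
have := above (n - i.+1)%N; rewrite subnKC // => /(_ (leqnn n)).
rewrite level_kernel_top cardsT cardG leq_exp2l // -ltnS -addSn subnKC //.
by rewrite ltnn.
Qed.

Theorem kernel_tower : exists N z c, tower F N z c.
Proof.
have [z zP] := choice level_step_exists.
exists level_kernel, z, level_shift; split=> //.
- exact: level_kernel_top.
- exact: level_kernel_bottom.
- exact: level_shiftE.
by move=> i x /level_kernelP.
Qed.

End KernelTower.

Section ArtinSchreierGenerators.
Variables (k : fieldType) (p n : nat) (G : finGroupType).
Hypotheses (chark : p \in [pchar k]) (cardG : #|G| = (p ^ n)%N).
Variables (y : 'I_n -> Dk k G) (F : G -> 'I_n -> {mpoly k[n]})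
  (sigma : 'I_n -> {mpoly k[n]}).
Hypothesis U : universal_subalg y F sigma.

(** If [g] acts trivially, the elements [b - b g] cannot generate the unit ideal. *)
Lemma universal_faithful g : (forall i, F g i = 'X_i) -> g = 1%g.
Proof.
move=> Fg; apply/eqP/negPn/negP => g1.
have [v tr_v] := universal_trace_one U.
have [s] := trace_one_moved chark (pgroup_setT chark cardG)
  (subst_is_act (universal_act_law U)) tr_v g1.
rewrite big1 => [/eqP|ab _]; first by rewrite oner_eq0.
by rewrite (subst_fix (upper_zero ab.2)) ?subrr ?mulr0.
Qed.

Theorem universal_artin_schreier : prime_field_steps F ->
  exists2 sigma' : 'I_n -> {mpoly k[n]},
    universal_subalg y F sigma' & artin_schreier_form p sigma'.
Proof.
move=> steps; have lawF := universal_act_law U.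
have tri g (i : 'I_n) : upper i.+1 (F g i - 'X_i).
  exact/vars_aboveP/(us_triangular U).
have [N [z [c tw]]] := kernel_tower chark cardG lawF steps tri universal_faithful.
have [sigma' [AS _ inv]] := tower_invariants chark tw.
exists sigma'; last exact: AS.
have inv' := embedded_invariants (us_alg_indep U) (us_stable U) inv.
apply: (UniversalSubalg (us_alg_indep U) (us_stable U) (us_trace_surjective U)
  (us_retract U) (us_triangular U) inv').
have inj := artin_schreier_injective (prime_gt1 (pcharf_prime chark)) AS.
exact: inj.
Qed.

End ArtinSchreierGenerators.

(** * Coordinates on the cosets of a chain of normal subgroups *)
Section RegularFunctions.
Variables (k : fieldType) (G : finGroupType).
Local Notation E := {ffun G -> k^o}.
Implicit Types (e b : E) (N M : {group G}).

(** The right action on functions under which the indicator function of [g] moves to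
    that of [g * h], as the generators of the universal algebra do. *)
Definition rtrans (h : G) (e : E) : E := [ffun g => e (g * h^-1)%g].

Lemma rtrans_is_linear h : linear (rtrans h).
Proof. by move=> a e e'; apply/ffunP => g; rewrite !ffunE. Qed.
HB.instance Definition _ h :=
  GRing.isLinear.Build k E E *:%R (rtrans h) (rtrans_is_linear h).

Lemma rtrans1 e : rtrans 1%g e = e.
Proof. by apply/ffunP => g; rewrite ffunE invg1 mulg1. Qed.

Lemma rtransM g h e : rtrans (g * h)%g e = rtrans h (rtrans g e).
Proof. by apply/ffunP => x; rewrite !ffunE invMg mulgA. Qed.

Definition const_fun (a : k) : E := [ffun=> a].

Lemma const_funE a : const_fun a = a *: const_fun 1.
Proof. by apply/ffunP => x; rewrite !ffunE [RHS]mulr1. Qed.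

Lemma rtrans_const_fun h a : rtrans h (const_fun a) = const_fun a.
Proof. by apply/ffunP => x; rewrite !ffunE. Qed.

Definition fixed_by (N : {set G}) (e : E) : Prop :=
  forall x, x \in N -> rtrans x e = e.

Lemma fixed_by_rtrans N h e : (N <| [set: G])%g -> fixed_by N e ->
  fixed_by N (rtrans h e).
Proof.
move=> nN fe x Nx; rewrite -rtransM -[in (h * x)%g](mulgK h^-1%g x).
rewrite invgK !mulgA rtransM fe // -[(h * x * h^-1)%g]mulgA -{1}[h]invgK.
by rewrite -conjgE memJ_norm ?(subsetP (normal_norm nN)) ?inE.
Qed.

(** On each coset of [M] such a function is a logarithm modulo [N] up to a constant, so
    its increments under translation are functions on the quotient by [M]: this makes
    them cocycles of the kind needed for the action on one more variable. *)
Record coset_coordinate (N M : {group G}) (c : G -> k) (b : E) : Prop :=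
  CosetCoordinate {
  coordinate_shift : forall x, x \in M -> rtrans x b = b + const_fun (c x);
  coordinate_diff : forall g, fixed_by M (rtrans g b - b)
}.

Variable p : nat.
Hypotheses (chark : p \in [pchar k]) (pG : (p.-group [set: G])%g).

Lemma natr_eq_mod (i j : nat) : (i == j %[mod p])%N -> i%:R = j%:R :> k.
Proof. by move/eqP=> e; rewrite -(natr_mod chark) e natr_mod. Qed.

(** A normal subgroup of order [p] in a [p]-group is central; applied to the quotient of
    [M] by [N], this makes its discrete logarithm invariant under conjugation. *)
Lemma central_step N M : (N <| [set: G])%g -> (M <| [set: G])%g -> N \subset M ->
  #|M| = (p * #|N|)%N ->
  exists (z : G) (c : G -> k), prime_step N M z c /\
    forall x g, x \in M -> c (x ^ g)%g = c x.
Proof.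
move=> nN nM sNM cardM; have p_pr := pcharf_prime chark.
have inN g : g \in 'N(N)%g by rewrite (subsetP (normal_norm nN)) ?inE.
have nNM : (N <| M)%g by apply: normalS nN; rewrite ?subsetT.
have oMN : #|(M / N)%g| = p.
  by rewrite card_quotient ?normal_norm // -divgS // cardM mulnK ?cardG_gt0.
have centMN : (M / N \subset 'Z([set: G] / N))%g.
  apply: prime_meetG; first by rewrite oMN.
  apply: meet_center_nil; first exact: (pgroup_nil (quotient_pgroup N pG)).
    exact: quotient_normal.
  by apply: contraTneq p_pr => MN1; rewrite -oMN MN1 cards1.
have [|zb defMN] := cyclicP (_ : cyclic (M / N)%g).
  by apply: prime_cyclic; rewrite oMN.
have ozb : #[zb]%g = p by rewrite /order -defMN.
have /morphimP[z _ Mz zbE] : zb \in (M / N)%g by rewrite defMN cycle_id.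
have exp x : exists m : nat, x \in M -> coset N x = (zb ^+ m)%g.
  case: (boolP (x \in M)) => [Mx|nx]; last by exists 0%N.
  have : coset N x \in <[zb]>%g by rewrite -defMN mem_quotient.
  by case/cycleP=> m ->; exists m.
have [m mE] := choice exp.
have mod_eq x l : x \in M -> coset N x = (zb ^+ l)%g -> (m x)%:R = l%:R :> k.
  move=> Mx; rewrite mE // => /eqP; rewrite eq_expg_mod_order ozb.
  exact: natr_eq_mod.
exists z, (fun x => (m x)%:R); split; last first.
  move=> x g Mx; apply: mod_eq.
    by rewrite memJ_norm ?(subsetP (normal_norm nM)) ?inE.
  have Zx : coset N x \in 'Z([set: G] / N)%g.
    by rewrite (subsetP centMN) ?mem_quotient.
  have comm : commute (coset N g) (coset N x).
    by apply: (centerC _ Zx); rewrite mem_quotient ?inE.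
  by rewrite morphJ // -mE // conjgE -comm mulKg.
split=> // [|x y Mx My|x Mx|x Mx].
- by rewrite (mod_eq z 1%N) ?expg1.
- rewrite -natrD; apply: mod_eq; first exact: groupM.
  by rewrite expgD -!mE //; apply: morphM; apply: inN.
- by exists (m x).
have kerE : (coset N x == 1)%g = (x \in N).
  by apply/eqP/idP => [/coset_idr->|/coset_id].
rewrite -kerE mE // -order_dvdn ozb (dvdn_pcharf chark).
by split=> /eqP.
Qed.

(** On each coset of [M] the function [b] is the discrete logarithm relative to a chosen
    representative, negated because translation acts through inverses.  Its translates
    shift by the same constants, as [c] is invariant under conjugation. *)
Lemma coordinate_exists N M z (c : G -> k) : prime_step N M z c -> (M <| [set: G])%g ->
  (forall x g, x \in M -> c (x ^ g)%g = c x) ->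
  exists b, coset_coordinate N M c b.
Proof.
move=> st nM cJ.
have c1 : c 1%g = 0 by apply/(step_ker st); exact: group1.
have cV x : x \in M -> c x^-1%g = - c x.
  move=> Mx; apply/eqP; rewrite -addr_eq0 -(step_morph st) ?groupV //.
  by rewrite mulVg c1.
pose b : E := [ffun g => - c ((repr (g *: M))^-1 * g)%g].
have shift x : x \in M -> rtrans x b = b + const_fun (c x).
  move=> Mx; apply/ffunP => g; rewrite !ffunE lcosetM lcoset_id ?groupV //.
  have Mu : ((repr (g *: M))^-1 * g)%g \in M.
    rewrite -groupV invMg invgK -mem_lcoset.
    exact: mem_repr (lcoset_refl _ g).
  by rewrite mulgA (step_morph st) ?groupV // cV // opprD opprK.
exists b; split=> // g x Mx.
have Mxg : (x ^ g^-1)%g \in M by rewrite memJ_norm ?(subsetP (normal_norm nM)) ?inE.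
rewrite raddfB /= -rtransM.
have -> : (g * x = x ^ g^-1 * g)%g by rewrite conjgE invgK !mulgA mulgKV.
rewrite rtransM (shift _ Mxg) (shift _ Mx) cJ // raddfD /= rtrans_const_fun.
by rewrite opprD addrACA subrr addr0.
Qed.

Lemma normal_chain (m : nat) (H : {group G}) : (H <| [set: G])%g -> #|H| = (p ^ m)%N ->
  exists N : nat -> {group G}, [/\ N m = H,
    forall i, (i <= m)%N -> (N i <| [set: G])%g /\ #|N i| = (p ^ i)%N
  & forall i, (i < m)%N -> N i \subset N i.+1].
Proof.
have p_pr := pcharf_prime chark.
elim: m H => [|m IH] H nH cardH.
  by exists (fun=> H); split=> // i; rewrite leqn0 => /eqP->.
have [|K [sKH nK cardK]] := @normal_pgroup p _ m _ H pG nH.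
  by rewrite cardH pfactorK.
have [N [Nm Nn Ns]] := IH K nK cardK.
exists (fun i => if i == m.+1 then H else N i); split=> [|i|i].
- by rewrite eqxx.
- rewrite leq_eqVlt; case: eqP => [->//|_] /= lt_im; exact: Nn.
rewrite ltnS => le_im; rewrite (ltn_eqF (leq_ltn_trans le_im (ltnSn m))) eqSS.
case: eqP => [->|/eqP ne]; first by rewrite Nm.
by apply: Ns; rewrite ltn_neqAle ne.
Qed.

Lemma coordinate_chain (n : nat) : #|G| = (p ^ n)%N ->
  exists (N : nat -> {group G}) (z : 'I_n -> G) (c : 'I_n -> G -> k)
    (b : 'I_n -> E),
  [/\ N n = [set: G] :> {set G}, N 0%N = 1%g :> {set G},
      forall i, (i <= n)%N -> (N i <| [set: G])%g,
      forall i : 'I_n, prime_step (N i) (N i.+1) (z i) (c i)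
    & forall i : 'I_n, coset_coordinate (N i) (N i.+1) (c i) (b i)].
Proof.
move=> cardG.
have [|N [Nn Nnorm Nsub]] := @normal_chain n [set: G]%G (normal_refl _).
  by rewrite cardsT.
have step (i : 'I_n) : exists zcb : G * (G -> k) * E,
    prime_step (N i) (N i.+1) zcb.1.1 zcb.1.2 /\
    coset_coordinate (N i) (N i.+1) zcb.1.2 zcb.2.
  have [nNi ci] := Nnorm i (ltnW (ltn_ord i)).
  have [nNi' ci'] := Nnorm i.+1 (ltn_ord i).
  have [|z [c [st cJ]]] := central_step nNi nNi' (Nsub i (ltn_ord i)).
    by rewrite ci ci' expnS.
  have [b bP] := coordinate_exists st nNi' cJ.
  by exists (z, c, b).
have [zcb zcbP] := choice step.
exists N, (fun i => (zcb i).1.1), (fun i => (zcb i).1.2), (fun i => (zcb i).2).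
split=> [||i|i|i].
- by rewrite Nn.
- apply/eqP; rewrite eq_sym eqEcard sub1G cards1.
  by have [_ ->] := Nnorm 0%N (leq0n n).
- by case/Nnorm.
- exact: (zcbP i).1.
exact: (zcbP i).2.
Qed.

End RegularFunctions.

(** * Building a triangular action one variable at a time *)
Section AveragedExtension.
Variables (k : fieldType) (G : finGroupType) (A : comAlgType k).
Local Notation E := {ffun G -> k^o}.
Variables (act : G -> {lrmorphism A -> A}) (N : {group G}) (theta : G -> k) (w : A).
Hypotheses (actP : is_act act) (nN : (N <| [set: G])%g) (wt : weight N theta).
Hypotheses (fix_w : forall x, x \in N -> act x w = w)
  (tr_w : relative_trace act theta w = 1).

(** The average of the conjugates of [psi], weighted by an element of relative trace 1:
    it is equivariant, and leaves [psi] unchanged wherever [psi] already was. *)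
Lemma averaged_extension (psi : {linear E -> A}) :
  (forall x e, x \in N -> act x (psi e) = psi e) ->
  exists s : {linear E -> A},
  [/\ forall e, s e = \sum_g theta g *: (act g w * act g (psi (rtrans g^-1%g e))),
      forall e h, fixed_by N e -> s (rtrans h e) = act h (s e)
    & forall e, (forall g, psi (rtrans g e) = act g (psi e)) -> s e = psi e].
Proof.
move=> fix_psi.
pose f e := \sum_g theta g *: (act g w * act g (psi (rtrans g^-1%g e))).
have f_lin : linear f.
  move=> a e e'; rewrite scaler_sumr -big_split; apply: eq_bigr => g _ /=.
  rewrite !linearP /= mulrDr scalerDr; congr (_ + _).
  by rewrite -scalerAr !scalerA mulrC.
pose fL := GRing.isLinear.Build k E A *:%R f f_lin.
pose s : {linear E -> A} := HB.pack f fL.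
have sE e : s e = f e by [].
exists s; split=> // [e h fe|e eq_psi].
  pose phi g := act g w * act g (psi (rtrans g^-1%g (rtrans h e))).
  have phiN x g : x \in N -> phi (x * g)%g = phi g.
    move=> Nx; rewrite /phi !actP.2 fix_w // invMg rtransM.
    rewrite (fixed_by_rtrans _ nN (fixed_by_rtrans _ nN fe)) ?groupV //.
    by rewrite fix_psi.
  rewrite !sE -[LHS](weight_sum_translate h wt phiN) rmorph_sum /=.
  apply: eq_bigr => g _; rewrite linearZ /= rmorphM /phi /= !actP.2.
  by rewrite -rtransM invMg mulKVg.
rewrite sE /f -[RHS]mul1r -tr_w mulr_suml; apply: eq_bigr => g _.
by rewrite eq_psi -actP.2 mulVg actP.1 scalerAl.
Qed.

(** The function [e => e (z^-1) - e 1] is a linear form that is 1 on [b] and 0 on the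
    functions invariant under [z], so the value at [b] is free. *)
Lemma linear_extension (s : {linear E -> A}) (z : G) (b : E) (x : A) :
  rtrans z b = b + const_fun G 1 ->
  exists psi : {linear E -> A},
  [/\ forall e, exists e' a, psi e = s e' + a *: x,
      psi b = x & forall e, rtrans z e = e -> psi e = s e].
Proof.
move=> zb; pose lam (e : E) : k := rtrans z e 1%g - e 1%g.
have lam_lin a e e' : lam (a *: e + e') = a * lam e + lam e'.
  rewrite /lam linearP /= !ffunE /= mulrBr [_ *: _]/(_ * _) opprD.
  by rewrite addrACA.
pose f e := s (e - lam e *: b) + lam e *: x.
have f_lin : linear f.
  move=> a e e'; rewrite /f lam_lin scalerDr addrACA -linearP /=.
  rewrite [in LHS]scalerDl [in LHS]scalerDl !scalerA.
  by rewrite scalerBr scalerA opprD addrACA.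
pose fL := GRing.isLinear.Build k E A *:%R f f_lin.
pose psi : {linear E -> A} := HB.pack f fL.
exists psi; split=> [e||e ze].
- by exists (e - lam e *: b), (lam e).
- have lb : lam b = 1 by rewrite /lam zb !ffunE addrAC subrr add0r.
  by rewrite -[LHS]/(f b) /f lb !scale1r subrr linear0 add0r.
have le : lam e = 0 by rewrite /lam ze subrr.
by rewrite -[LHS]/(f e) /f le !scale0r subr0 addr0.
Qed.

End AveragedExtension.

Section UniversalPolynomials.
Variables (k : fieldType) (p n : nat) (G : finGroupType).
Hypothesis chark : p \in [pchar k].
Local Notation P := {mpoly k[n]}.
Local Notation E := {ffun G -> k^o}.
Variables (N : nat -> {group G}) (z : 'I_n -> G) (c : 'I_n -> G -> k)
  (b : 'I_n -> E).
Hypothesis N_top : N n = [set: G] :> {set G}.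
Hypothesis N_normal : forall i, (i <= n)%N -> (N i <| [set: G])%g.
Hypothesis N_step : forall i : 'I_n, prime_step (N i) (N i.+1) (z i) (c i).
Hypothesis N_coord : forall i : 'I_n, coset_coordinate (N i) (N i.+1) (c i) (b i).

(** The variables of index at least [i] carry their final action and the others are still
    fixed.  The linear map [s] shows that the moving variables lie in the image of a
    quotient of the regular representation, which is what makes the polynomial ring a
    quotient of the universal algebra in the end. *)
Record partial_model (i : nat) (F : G -> 'I_n -> P) (theta : G -> k) (w : P)
    (s : {linear E -> P}) : Prop := PartialModel {
  model_law : action_law F;
  model_triangular : forall g (j : 'I_n), upper j.+1 (F g j - 'X_j);
  model_idle : forall g (j : 'I_n), (j < i)%N -> F g j = 'X_j;
  model_fix : forall x, x \in N i -> forall j, F x j = 'X_j;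
  model_shift : forall j : 'I_n, (i <= j)%N ->
    forall x, x \in N j.+1 -> F x j = 'X_j + (c j x)%:MP;
  model_weight : weight (N i) theta;
  model_upper : upper i w;
  model_trace : relative_trace (subst F) theta w = 1;
  model_lin_upper : forall e, upper i (s e);
  model_equivariant : forall e, fixed_by (N i) e ->
    forall h, s (rtrans h e) = subst F h (s e);
  model_one : s (const_fun G 1) = 1;
  model_coord : forall j : 'I_n, (i <= j)%N -> s (b j) = 'X_j
}.

Lemma partial_model_top :
  exists F theta w s, partial_model n F theta w s.
Proof.
pose F (g : G) (j : 'I_n) : P := 'X_j.
have idF g q : subst F g q = q by apply: subst_fix (upper_zero q) _.
pose f (e : E) : P := (e 1%g : k)%:MP.
have f_lin : linear f.
  by move=> a e e'; rewrite /f !ffunE mpolyCD mpolyCM mul_mpolyC.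
pose fL := GRing.isLinear.Build k E P *:%R f f_lin.
pose s : {linear E -> P} := HB.pack f fL.
exists F, (fun g => (g == 1%g)%:R), 1, s; split=> //.
- by split=> [//|g h j]; rewrite idF.
- by move=> g j; rewrite /F subrr; apply: upper0.
- by move=> j; rewrite leqNgt ltn_ord.
- by rewrite N_top; apply: weight_setT.
- exact: upper1.
- rewrite /relative_trace (bigD1 1%g) //= eqxx scale1r rmorph1 big1 ?addr0 //.
  by move=> g /negPf->; rewrite scale0r.
- by move=> e; apply: upperC.
- move=> e fe h; have Nh : h \in N n by rewrite N_top inE.
  by rewrite idF (fe h Nh).
- by rewrite -[LHS]/(f _) /f ffunE mpolyC1.
by move=> j; rewrite leqNgt ltn_ord.
Qed.

(** The increments [s (b_i g - b_i)] of the new variable are a cocycle because [s] is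
    equivariant on functions invariant under [N i.+1].  To extend [s], first send [b_i]
    to the new variable linearly, then average. *)
Lemma partial_model_down (i : 'I_n) :
  (exists F theta w s, partial_model i.+1 F theta w s) ->
  exists F theta w s, partial_model i F theta w s.
Proof.
case=> F [theta [w [s M]]]; have [F1 FM] := model_law M.
have st := N_step i; have co := N_coord i.
pose d g : E := rtrans g (b i) - b i.
pose F' g (j : 'I_n) : P := if j == i then 'X_i + s (d g) else F g j.
have F'i g : F' g i = 'X_i + s (d g) by rewrite /F' eqxx.
have F'E g (j : 'I_n) : j != i -> F' g j = F g j by rewrite /F' => /negPf->.
have subE g q : upper i.+1 q -> subst F' g q = subst F g q.
  move=> uq; apply: upper_mev_ext uq _ => j lt_ij; apply: F'E.
  by apply: contraTneq lt_ij => ->; rewrite ltnn.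
have d1 : d 1%g = 0 by rewrite /d rtrans1 subrr.
have dM g h : s (d (g * h)%g) = subst F h (s (d g)) + s (d h).
  have -> : d (g * h)%g = rtrans h (d g) + d h.
    by rewrite /d raddfB /= rtransM addrA subrK.
  by rewrite linearD /= (model_equivariant M (coordinate_diff co g)).
have shift x : x \in N i.+1 -> s (d x) = (c i x)%:MP.
  move=> Nx; rewrite /d (coordinate_shift co Nx) addrAC subrr add0r.
  by rewrite const_funE linearZ /= (model_one M) -alg_mpolyC.
have law' : action_law F'.
  split=> [j|g h j].
    by case: (eqVneq j i) => [->|ne]; rewrite ?F'i ?F'E ?d1 ?linear0 ?addr0.
  case: (eqVneq j i) => [->|ne].
    rewrite !F'i dM [RHS]rmorphD [X in _ = X + _]substX F'i.
    rewrite -[X in _ = _ + X]/(subst F' h (s (d g))) subE;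
      last exact: model_lin_upper M _.
    by rewrite [subst F h _ + _]addrC addrA.
  rewrite !F'E // FM; case: (ltngtP j i) => [lt_ji|lt_ij|/val_inj e].
  - have idle := model_idle M _ (leqW lt_ji).
    by rewrite idle [LHS]substX [RHS]substX F'E // idle.
  - rewrite subE // -(subrK 'X_j (F g j)); apply: upperD; last exact: upperX.
    by apply: upper_le (model_triangular M g j); apply: ltnW.
  by rewrite e eqxx in ne.
have act' : is_act (subst F') := subst_is_act law'.
have tri' g (j : 'I_n) : upper j.+1 (F' g j - 'X_j).
  case: (eqVneq j i) => [->|ne]; last by rewrite F'E //; apply: model_triangular M _ _.
  by rewrite F'i addrAC subrr add0r; apply: model_lin_upper M _.
have fix' x : x \in N i -> forall j, F' x j = 'X_j.
  move=> Nx j; have Nx' := subsetP (step_sub st) _ Nx.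
  case: (eqVneq j i) => [->|ne]; last by rewrite F'E // (model_fix M).
  by rewrite F'i shift // (step_ker st Nx').2 // mpolyC0 addr0.
have subN x q : x \in N i -> subst F' x q = q.
  by move=> Nx; apply: subst_fix (upper_zero q) _ => j _; apply: fix'.
pose theta' := refine_weight p (z i) theta.
pose w' := - (w * 'X_i ^+ p.-1).
have wt' : weight (N i) theta' := weight_step chark st (model_weight M).
have uw' : upper i w'.
  apply/upperN/upperM; last by apply/upperXn/upperX.
  by apply: upper_le (model_upper M).
have tr' : relative_trace (subst F') theta' w' = 1.
  apply: (trace_one_refine chark act').
  - rewrite -(model_trace M); apply: eq_bigr => g _.
    by rewrite (subE _ _ (model_upper M)).
  - rewrite (subE _ _ (model_upper M)); apply: subst_fix (upper_zero w) _ => j _.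
    by apply: (model_fix M); apply: step_mem st.
  by rewrite substX F'i shift ?(step_mem st) // (step_gen st) mpolyC1.
have zb : rtrans (z i) (b i) = b i + const_fun G 1.
  by rewrite (coordinate_shift co (step_mem st)) (step_gen st).
have [psi [psi_form psi_b psi_s]] := linear_extension s ('X_i : P) zb.
have [s' [s'E s'_equi s'_ext]] := averaged_extension act'
  (N_normal (ltnW (ltn_ord i))) wt' (fun x Nx => subN x w' Nx) tr'
  (fun x e Nx => subN x (psi e) Nx).
have psi_low e : fixed_by (N i.+1) e -> psi e = s e.
  by move=> fe; apply/psi_s/fe/(step_mem st).
have s'_low e : fixed_by (N i.+1) e -> s' e = s e.
  move=> fe; rewrite s'_ext psi_low // => g.
  rewrite psi_low; last exact: fixed_by_rtrans (N_normal (ltn_ord i)) fe.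
  by rewrite (model_equivariant M fe) (subE _ _ (model_lin_upper M e)).
exists F', theta', w', s'; split=> //.
- move=> g j lt_ji; rewrite F'E ?(model_idle M) ?(leqW lt_ji) //.
  by apply: contraTneq lt_ji => ->; rewrite ltnn.
- move=> j; rewrite leq_eqVlt => /predU1P[/val_inj <- x Nx|lt_ij x Nx].
    by rewrite F'i shift.
  rewrite F'E ?(model_shift M) //.
  by apply: contraTneq lt_ij => ->; rewrite ltnn.
- move=> e; rewrite s'E; apply: upper_sum => g _; apply/upperZ/upperM.
    exact: subst_upper tri' _ _ _ uw'.
  apply: subst_upper tri' _ _ _ _; have [e' [a ->]] := psi_form (rtrans g^-1%g e).
  apply: upperD; last by apply/upperZ/upperX.
  by apply: upper_le (model_lin_upper M e').
- by move=> e fe h; apply: s'_equi.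
- by rewrite s'_low ?(model_one M) // => x _; apply: rtrans_const_fun.
move=> j; rewrite leq_eqVlt => /predU1P[/val_inj <-|lt_ij].
  rewrite s'_ext psi_b // => g; rewrite substX F'i.
  rewrite -[rtrans g (b i)](subrK (b i)) linearD /= psi_b addrC.
  by rewrite psi_low //; apply: coordinate_diff co g.
rewrite s'_low ?(model_coord M) // => x Nx.
have Nxj : x \in N j.
  elim: (val j) lt_ij (ltnW (ltn_ord j)) => [//|m IH]; rewrite ltnS leq_eqVlt.
  case/predU1P=> [<- //|lt_im lt_mn].
  apply: (subsetP (step_sub (N_step (Ordinal lt_mn)))).
  by apply: IH => //; apply: ltnW.
have Nxj' := subsetP (step_sub (N_step j)) _ Nxj.
rewrite (coordinate_shift (N_coord j) Nxj') (step_ker (N_step j) Nxj').2 //.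
by apply/ffunP => g; rewrite !ffunE addr0.
Qed.

Lemma model_exists : exists F theta w s, partial_model 0 F theta w s.
Proof.
pose Q i := exists F theta w s, partial_model i F theta w s.
exact: (@down_ind n Q partial_model_top partial_model_down 0%N (leq0n n)).
Qed.

Hypothesis N_bottom : N 0%N = 1%g :> {set G}.

Lemma model_tower F theta w s : partial_model 0 F theta w s -> tower F N z c.
Proof.
move=> M; split=> //.
- exact: model_law M.
- exact: model_triangular M.
- by move=> i x; apply: (model_shift M).
move=> i x Nx j le_ij.
have Nxj (m : nat) : (i <= m)%N -> (m <= n)%N -> x \in N m.
  elim: m => [|m IH]; first by rewrite leqn0 => /eqP <-.
  rewrite leq_eqVlt => /predU1P[<- //|lt_im lt_mn].
  apply: (subsetP (step_sub (N_step (Ordinal lt_mn)))).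
  by apply: IH => //; apply: ltnW.
have Nx0 := Nxj j le_ij (ltnW (ltn_ord j)).
have Nx1 := Nxj j.+1 (leqW le_ij) (ltn_ord j).
by rewrite (model_shift M) // (step_ker (N_step j) Nx1).2 // mpolyC0 addr0.
Qed.

(** An element that fixes all the variables after the one of index [i] is pushed down the
    chain until it lies in [N i.+1], since at every level only the kernel of [c] acts
    trivially. *)
Lemma tower_prime_field_steps F : tower F N z c -> prime_field_steps F.
Proof.
move=> tw g i Fg.
suff Ng : g \in N i.+1.
  by rewrite (tower_shift tw Ng); have [m ->] := step_nat (N_step i) Ng;
    exists m; rewrite rmorph_nat.
have H j : (j <= n)%N -> (i < j)%N -> g \in N j.
  move: j; apply: down_ind => [_|j IH lt_ij]; first by rewrite N_top inE.
  have Ng := IH (leqW lt_ij); apply/(step_ker (N_step j) Ng).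
  have := tower_shift tw Ng; rewrite Fg // -[LHS]addr0 => /addrI.
  by move/(congr1 (mcoeff 0%MM)); rewrite mpolyCK mcoeff0.
exact: H (ltn_ord i) (ltnSn i).
Qed.

End UniversalPolynomials.

(** * The polynomial ring as a retract of the universal algebra *)
Section RegularLinearForms.
Variables (k : fieldType) (G : finGroupType).
Local Notation E := {ffun G -> k^o}.

Definition delta (g : G) : E := [ffun x => (x == g)%:R].

Lemma rtrans_delta g h : rtrans h (delta g) = delta (g * h)%g.
Proof.
by apply/ffunP => x; rewrite !ffunE -(inj_eq (mulIg h)) mulgKV.
Qed.

Lemma sum_delta (e : E) : e = \sum_g (e g : k) *: delta g.
Proof.
apply/ffunP => x; rewrite sum_ffunE (bigD1 x) //= big1 => [|g gx].
  by rewrite !ffunE eqxx addr0 [RHS]mulr1.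
by rewrite !ffunE eq_sym (negPf gx) [LHS]mulr0.
Qed.

Lemma sum_delta_one : \sum_g delta g = const_fun G 1.
Proof.
rewrite [RHS]sum_delta; apply: eq_bigr => g _.
by rewrite ffunE scale1r.
Qed.

Definition linear_form (e : E) : Dk k G := \sum_g (e g : k) *: dX k g.

End RegularLinearForms.

Section Embedding.
Variables (k : fieldType) (n : nat) (G : finGroupType).
Local Notation P := {mpoly k[n]}.
Local Notation E := {ffun G -> k^o}.
Variables (N : nat -> {group G}) (z : 'I_n -> G) (c : 'I_n -> G -> k).
Variables (F : G -> 'I_n -> P) (tw : tower F N z c).
Variables (s : {linear E -> P}) (b : 'I_n -> E).
Hypothesis s_equivariant : forall e h, s (rtrans h e) = subst F h (s e).
Hypothesis s_one : s (const_fun G 1) = 1.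
Hypothesis s_coord : forall i, s (b i) = 'X_i.

Let subP : is_act (subst F) := subst_is_act (tower_act tw).
Let dactP : is_act (@dact k G) := galg_is_act (@Dact_galg k G).

Lemma projection_exists : exists pi : {lrmorphism Dk k G -> P},
  (forall e, pi (linear_form e) = s e) /\
  (forall x g, pi (dact g x) = subst F g (pi x)).
Proof.
have sg g : subst F g (s (delta k 1%g)) = s (delta k g).
  by rewrite -s_equivariant rtrans_delta mul1g.
have [|pi [piX pi_act]] := Dk_universal subP (v := s (delta k 1%g)).
  under eq_bigr do rewrite sg.
  by rewrite -linear_sum /= sum_delta_one s_one.
exists pi; split=> [e|x g]; last exact: pi_act.
rewrite [in RHS](sum_delta e) [LHS](raddf_sum pi) [RHS](raddf_sum s).
apply: eq_bigr => g _.
by rewrite [LHS]linearZ [RHS]linearZ; congr (_ *: _); rewrite -sg; apply: piX.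
Qed.

Lemma trace_dX : relative_trace dact (fun=> 1) (dX k (1%g : G)) = 1.
Proof.
rewrite -[RHS]sum_dX; apply: eq_bigr => g _.
by rewrite scale1r dact_dX mul1g.
Qed.

Variable pi : {lrmorphism Dk k G -> P}.
Hypothesis pi_form : forall e, pi (linear_form e) = s e.
Hypothesis pi_act : forall x g, pi (dact g x) = subst F g (pi x).

Let lifted (i : nat) : Prop := exists y : 'I_n -> Dk k G,
  (forall j, pi (y j) = 'X_j) /\
  (forall j : 'I_n, (i <= j)%N -> forall g, dact g (y j) = mev y (F g j)).

Lemma lifted_top : lifted n.
Proof.
exists (fun j => linear_form (b j)); split=> j.
  by rewrite pi_form s_coord.
by rewrite leqNgt ltn_ord.
Qed.

(** Any preimage [l] of the variable of index [i] fails to move correctly by a cocycle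
    [e] with values in the kernel of [pi].  Its splitting is a combination of these
    values, hence lies in the kernel too, and correcting [l] by it is harmless. *)
Lemma lifted_down (i : 'I_n) : lifted i.+1 -> lifted i.
Proof.
move=> [y [pi_y y_act]]; have tri := tower_triangular tw.
have pi_mev q : pi (mev y q) = q.
  by rewrite mev_comp -[RHS]mev_id; congr (mev _ q); apply/funext.
have mev_act h q : upper i.+1 q -> mev y (subst F h q) = dact h (mev y q).
  move=> uq; rewrite [LHS]mev_comp [RHS]mev_comp; apply: upper_mev_ext uq _.
  by move=> j lt_ij; rewrite -[RHS]/(dact h (y j)) y_act.
have pi_l : pi (linear_form (b i)) = 'X_i by rewrite pi_form s_coord.
move: (linear_form (b i)) pi_l => l pi_l; pose q g : P := F g i - 'X_i.
pose e g := mev y (q g) - (dact g l - l).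
have cocyc g h : e (g * h)%g = dact h (e g) + e h.
  have qM : q (g * h)%g = subst F h (q g) + q h.
    by rewrite /q (tower_act tw).2 rmorphB /= -/(subst F h) substX addrA subrK.
  have eD : dact h (e g) =
      dact h (mev y (q g)) - (dact h (dact g l) - dact h l).
    by rewrite -[in RHS]rmorphB -[in RHS]rmorphB.
  rewrite eD /e qM [mev y _]rmorphD [X in X + _ - _]mev_act; last exact: tri.
  by rewrite dactP.2 [RHS]addrACA -opprD [in RHS]addrA subrK.
have e1 x : x \in [1 G]%G -> e x = 0.
  move/set1P->; rewrite /e /q (tower_act tw).1 dactP.1 !subrr.
  by rewrite rmorph0 subrr.
have fix1 x : x \in [1 G]%G -> dact x (dX k (1%g : G)) = dX k 1%g.
  by move/set1P->; apply: dactP.1.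
have split_e := cocycle_split dactP (@weight_one k G) fix1 trace_dX cocyc e1.
set b0 := \sum_g _ in split_e.
have pi_e g : pi (e g) = 0.
  rewrite /e [LHS]rmorphB [X in X - _]pi_mev [X in _ - X]rmorphB.
  by rewrite [X in _ - (X - _)]pi_act [X in _ - (_ - X)]pi_l pi_l substX subrr.
have pi_b0 : pi b0 = 0.
  rewrite [LHS](raddf_sum pi) big1 // => g _; rewrite scale1r.
  by apply: etrans (rmorphM pi _ _) _; rewrite [X in _ * X]pi_e mulr0.
pose y' j := if j == i then l - b0 else y j.
have y'E (j : 'I_n) : (i < j)%N -> y' j = y j.
  by move=> lt_ij; rewrite /y'; case: eqP lt_ij => // ->; rewrite ltnn.
have y'i : y' i = l - b0 by rewrite /y' eqxx.
have mev_y' r : upper i.+1 r -> mev y' r = mev y r.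
  by move=> ur; apply: upper_mev_ext ur _ => j; apply: y'E.
exists y'; split=> j.
  rewrite /y'; case: eqP => [->|_]; last exact: pi_y.
  by rewrite rmorphB /= pi_l pi_b0 subr0.
rewrite leq_eqVlt => /predU1P[/val_inj <- g|lt_ij g]; last first.
  rewrite (y'E _ lt_ij) (y_act _ lt_ij); apply/esym/mev_y'.
  rewrite -(subrK 'X_j (F g j)); apply: upperD; last exact: upperX.
  by apply: upper_le (tri g j); apply: leqW.
rewrite -[in RHS](subrK 'X_i (F g i)) [RHS]rmorphD [X in _ = _ + X]mevX.
rewrite [X in _ = X + _]mev_y' ?y'i; last exact: tri.
have eE : mev y (F g i - 'X_i) = (dact g l - l) + e g.
  by rewrite /e [RHS]addrC subrK.
have e_b0 : e g = b0 - dact g b0 by rewrite -opprB split_e opprK.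
rewrite eE e_b0 [LHS]rmorphB -[RHS]addrA [X in _ = _ + X]addrC.
by rewrite [X in _ = _ + X]addrA subrK [RHS]addrA subrK.
Qed.

Lemma lift_exists : exists y : 'I_n -> Dk k G,
  (forall j, pi (y j) = 'X_j) /\ (forall g j, dact g (y j) = mev y (F g j)).
Proof.
have [y [pi_y y_act]] := down_ind lifted_top lifted_down (leq0n n).
by exists y; split=> // g j; apply: y_act.
Qed.

End Embedding.

Section Retract.
Variables (k : fieldType) (n : nat) (G : finGroupType).
Local Notation P := {mpoly k[n]}.
Variables (F : G -> 'I_n -> P) (y : 'I_n -> Dk k G) (sigma : 'I_n -> P).
Variable pi : {lrmorphism Dk k G -> P}.
Hypothesis triangular : forall g (i : 'I_n), upper i.+1 (F g i - 'X_i).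
Hypothesis pi_y : forall i, pi (y i) = 'X_i.
Hypothesis pi_act : forall x g, pi (dact g x) = subst F g (pi x).
Hypothesis y_act : forall g i, dact g (y i) = mev y (F g i).
Hypothesis trace_one : exists w, \sum_g subst F g w = 1.
Hypothesis invariants : forall q,
  (forall g, subst F g q = q) <-> exists q', q = mev sigma q'.
Hypothesis sigma_inj : injective (mev sigma).

Lemma retract_pi q : pi (mev y q) = q.
Proof.
by rewrite mev_comp -[RHS]mev_id; congr (mev _ q); apply/funext.
Qed.

Lemma retract_inj : injective (mev y).
Proof. by move=> q r e; rewrite -(retract_pi q) e retract_pi. Qed.

Let retract_act := embedded_equivariant y_act.

Lemma retract_trace_surjective u : in_subalg y u -> ginvariant (Dact k G) u ->
  exists2 v, in_subalg y v & transfer (Dact k G) v = u.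
Proof.
move=> [q ->] /(embedded_invariant retract_inj y_act) q_inv; have [w tr_w] := trace_one.
exists (mev y (q * w)); first by exists (q * w).
transitivity (mev y (\sum_g subst F g (q * w))).
  rewrite [RHS]raddf_sum; apply: eq_bigr => g _.
  exact: retract_act.
congr mev; rewrite -[RHS]mulr1 -tr_w mulr_sumr; apply: eq_bigr => g _.
by rewrite [LHS]rmorphM [X in X * _]q_inv.
Qed.

Lemma retract_ideal : exists I : {pred Dk k G},
  [/\ idealr_closed I,
      forall x g, x \in I -> Dact k G x g \in I,
      forall x, exists u v, [/\ in_subalg y u, v \in I & x = u + v]
    & forall x, in_subalg y x -> x \in I -> x = 0].
Proof.
pose I : {pred Dk k G} := fun x => pi x == 0.
have memI x : (x \in I) = (pi x == 0) by [].
exists I; split.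
- split; first by rewrite memI rmorph0.
    by rewrite memI rmorph1 oner_eq0.
  move=> a u v; rewrite !memI => /eqP pu /eqP pv.
  rewrite [pi _]rmorphD [X in X + _]rmorphM [X in _ * X + _]pu [X in _ + X]pv.
  by rewrite mulr0 addr0.
- move=> x g; rewrite !memI => /eqP px; rewrite -[Dact k G x g]/(dact g x).
  by rewrite pi_act px rmorph0.
- move=> x; exists (mev y (pi x)), (x - mev y (pi x)); split.
  + by exists (pi x).
  + by rewrite memI [pi _]rmorphB [X in _ - X]retract_pi subrr.
  + by rewrite addrC subrK.
move=> x [q ->]; rewrite memI retract_pi => /eqP ->.
exact: rmorph0.
Qed.

Lemma retract_universal : universal_subalg y F sigma.
Proof.
have tri g i : vars_above i (F g i - 'X_i) by apply/vars_aboveP.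
exact: (UniversalSubalg retract_inj y_act retract_trace_surjective retract_ideal
  tri (embedded_invariants retract_inj y_act invariants) sigma_inj).
Qed.

End Retract.

Theorem universal_exists (k : fieldType) (p n : nat) (G : finGroupType) :
  p \in [pchar k] -> #|G| = (p ^ n)%N ->
  exists (y : 'I_n -> Dk k G) (F : G -> 'I_n -> {mpoly k[n]})
    (sigma : 'I_n -> {mpoly k[n]}),
  [/\ universal_subalg y F sigma, prime_field_steps F
    & artin_schreier_form p sigma].
Proof.
move=> chark cardG.
have [N [z [c [b [Ntop Nbot Nnorm Nstep Ncoord]]]]] :=
  coordinate_chain chark (pgroup_setT chark cardG) cardG.
have [F [theta [w [s M]]]] := model_exists chark Ntop Nnorm Nstep Ncoord.
have tw := model_tower Ntop Nstep Nbot M.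
have s_equi e h : s (rtrans h e) = subst F h (s e).
  apply: (model_equivariant M) => x; rewrite Nbot => /set1P->.
  exact: rtrans1.
have s_coord i : s (b i) = 'X_i by apply: (model_coord M).
have [pi [pi_form pi_act]] := projection_exists tw s_equi (model_one M).
have [y [pi_y y_act]] := lift_exists tw s_coord pi_form pi_act.
have [sigma [AS tr1 inv]] := tower_invariants chark tw.
have sigma_inj := artin_schreier_injective (prime_gt1 (pcharf_prime chark)) AS.
exists y, F, sigma.
split; [|exact: (tower_prime_field_steps Ntop Nstep tw)|exact: AS].
exact: (retract_universal (model_triangular M) pi_y pi_act y_act tr1 inv sigma_inj).
Qed.

Theorem theorem1p2 (k : fieldType) (p n : nat) (G : finGroupType)
  (chark : p \in [pchar k]) (cardG : #|G| = (p ^ n)%N) :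
  (forall (y : 'I_n -> Dk k G) (F : G -> 'I_n -> {mpoly k[n]})
      (sigma : 'I_n -> {mpoly k[n]}),
    universal_subalg y F sigma ->
    (forall (R A : comAlgType k) (to : {action G &-> A})
        (iota : {lrmorphism R -> A}),
      galg_action to -> trace_surjective to ->
      injective iota ->
      (forall a, ginvariant to a <-> exists c, a = iota c) ->
      exists (r : 'I_n -> R) (proper : 1 \notin ideal_gen (fiber_eqs sigma r))
        (phi : {rmorphism alg_quot proper -> A}),
        [/\ bijective phi,
            forall c : R, phi (qpi proper (mpolyC n c)) = iota c
          & forall (P : {mpoly R[n]}) (g : G),
              phi (qpi proper (poly_act F P g)) = to (phi (qpi proper P)) g])
    /\ (prime_field_steps F ->
        exists2 sigma' : 'I_n -> {mpoly k[n]},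
          universal_subalg y F sigma' & artin_schreier_form p sigma'))
  /\ (exists (y : 'I_n -> Dk k G) (F : G -> 'I_n -> {mpoly k[n]})
        (sigma : 'I_n -> {mpoly k[n]}),
      [/\ universal_subalg y F sigma, prime_field_steps F
        & artin_schreier_form p sigma]).
Proof.
split=> [y F sigma U|]; last exact: (universal_exists chark cardG).
split=> [R A to iota toP to_tr iota_inj inv_iota|steps].
  exact: (universal_structure chark cardG U toP to_tr iota_inj inv_iota).
exact: (universal_artin_schreier chark cardG U steps).
Qed.
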